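(* Suppose that there exists $\xi>\max\{4(B+1),8\}$ such that $\sqrt N(\log N)^{\xi}=O(\theta_N)$ and $\theta_N=O(N)$, and that $\{h_1,\dots,h_k\}$ is an orthonormal set of bounded functions in $L^2[0,1]$. Then for every $1\le i\le k$, as $N\to\infty$, $$\lambda_i(A)=\theta\alpha_i\,(1+o_{hp}(1)).$$
   Context: Model: fix an integer $k\ge1$, constants $\alpha_1>\alpha_2>\dots>\alpha_k>0$, a constant $B>0$, and a bounded Riemann-integrable function $f:[0,1]^2\to[0,\infty)$. For each $N$, $W=W_N$ is the $N\times N$ random symmetric matrix $W_N(j,\ell)=X_{j\wedge\ell,\,j\vee\ell}$, where $\{X_{j,\ell}:1\le j\le\ell\le N\}$ are independent (not necessarily identically distributed) random variables with mean $0$, variance $f(j/N,\ell/N)$, and $\mathbb E|X_{j,\ell}|^m\le m^{Bm}$ for all $m\ge1$. The vectors $e_1,\dots,e_k$ are deterministic unit vectors in $\mathbb R^N$ obtained by discretizing functions $h_1,\dots,h_k$ on $[0,1]$: the $\ell$-th entry of the column vector $e_i$ is $h_i(\ell/N)/\sqrt N$. (The orthonormality assumption on the $h_i$ is regarded as equivalent to asymptotic orthonormality of the $e_i$, that is, $e_i'e_j=\langle h_i,h_j\rangle_{L^2[0,1]}+o(1)$.) For a deterministic scalar $\theta=\theta_N>0$, which may grow with $N$, put $A=A_N=W_N+\theta_N\sum_{i=1}^k\alpha_i e_ie_i'$ (prime denotes transpose). $\lambda_1(A)\ge\dots\ge\lambda_N(A)$ are the ordered eigenvalues of $A$. Events $E_N$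 occur with high probability (w.h.p.) if $P(E_N^c)=O(e^{-(\log N)^\eta})$ for some $\eta>1$. $Y_N=o_{hp}(Z_N)$ means that for every $\delta>0$, $|Y_N|\le\delta|Z_N|$ w.h.p. as $N\to\infty$. *)

(* Defs.v *)
From HB Require Import structures.
From mathcomp Require Import all_boot all_order all_algebra.
From mathcomp Require Import all_classical all_reals all_analysis.
From mathcomp.real_closed Require complex.

Set Implicit Arguments.
Unset Strict Implicit.
Unset Printing Implicit Defensive.

Import Order.TTheory GRing.Theory Num.Theory.
Import numFieldNormedType.Exports.

Local Open Scope classical_set_scope.
Local Open Scope ring_scope.

Section Functions.
Context {R : realType}.

Definition bounded_on01 (h : R -> R) :=
  exists M : R, forall x : R, x \in `[0, 1] -> `|h x| <= M.

Definition bounded_on_square (f : R -> R -> R) :=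
  exists M : R, forall x y : R, x \in `[0, 1] -> y \in `[0, 1] -> `|f x y| <= M.

Definition partition01 (n : nat) (x : nat -> R) :=
  [/\ x 0%N = 0, x n = 1 & forall a, (a < n)%N -> x a <= x a.+1].

(* Convergence of the tagged Riemann sums over grids x_0 <= .. <= x_m,
   y_0 <= .. <= y_n of the unit square as the mesh goes to 0; (s a b, t a b)
   is the tag of the cell (a, b). *)
Definition riemann_integrable_square (f : R -> R -> R) :=
  exists v : R, forall eps : R, 0 < eps -> exists2 delta : R, 0 < delta &
    forall (m n : nat) (x y : nat -> R) (s t : nat -> nat -> R),
      partition01 m x -> partition01 n y ->
      (forall a, (a < m)%N -> x a.+1 - x a < delta) ->
      (forall b, (b < n)%N -> y b.+1 - y b < delta) ->
      (forall a b, (a < m)%N -> (b < n)%N ->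
         x a <= s a b <= x a.+1 /\ y b <= t a b <= y b.+1) ->
      `|\sum_(0 <= a < m) \sum_(0 <= b < n)
          f (s a b) (t a b) * (x a.+1 - x a) * (y b.+1 - y b) - v| < eps.

Definition inner01 (h g : R -> R) : R :=
  \int[lebesgue_measure]_(x in `[0, 1]) (h x * g x).

Definition orthonormal01 (k : nat) (h : 'I_k -> R -> R) :=
  (forall i, measurable_fun (`[0, 1] : set R) (h i)) /\
  (forall i j, inner01 (h i) (h j) = (i == j)%:R).

(* Positions are 1, .., N in the mathematics and 0, .., N - 1 in 'I_N. *)
Definition gridpt (N : nat) (l : 'I_N) : R := l.+1%:R / N%:R.

Definition discretize (N : nat) (h : R -> R) : 'cV[R]_N :=
  \col_l (h (gridpt l) / Num.sqrt N%:R).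

(* The real eigenvalues with multiplicity, in nonincreasing order. The two
   conditions determine the sequence; for a symmetric matrix it exists, see
   ordered_eigenvaluesP. *)
Definition ordered_eigenvalues (N : nat) (A : 'M[R]_N) : seq R :=
  xget [::] [set s : seq R | sorted >=%R s /\
                             char_poly A = \prod_(x <- s) ('X - x%:P)].

(* Indexed from 0: eigval A 0 is the largest eigenvalue. *)
Definition eigval (N : nat) (A : 'M[R]_N) (i : nat) : R :=
  (ordered_eigenvalues A)`_i.

End Functions.

Section SpectralTheorem.
Import complex.
Context {R : realType}.

Lemma ordered_eigenvaluesP (N : nat) (A : 'M[R]_N) : A^T = A ->
  [/\ sorted >=%R (ordered_eigenvalues A),
      char_poly A = \prod_(x <- ordered_eigenvalues A) ('X - x%:P) &
      size (ordered_eigenvalues A) = N].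
Proof.
move=> AT; rewrite /ordered_eigenvalues; case: xgetP => [s _ [ss sE]|noP].
  split => //; apply: succn_inj.
  by rewrite -(size_char_poly A) sE size_prod_XsubC.
exfalso.
pose toC := complex.real_complex R.
pose M := map_mx toC A; pose P := spectralmx M; pose D := spectral_diag M.
have realC x : toC x \is Num.real by apply/complex.complex_realP; exists x.
have Mh : M \is hermsymmx.
  apply: realsym_hermsym; last by apply/mxOverP => i j; rewrite mxE realC.
  by apply/is_hermitianmxP; rewrite expr0 scale1r map_mx_id// /M map_trmx AT.
have ME : M = invmx P *m diag_mx D *m P.
  exact/orthomx_spectralP/hermitian_normalmx.
have Pu : P \in unitmx := spectral_unit M.
have DE j : toC (complex.Re (D 0 j)) = D 0 j.
  have /mxOverP/(_ 0 j)/complex.complex_realP[x ->] :=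
    hermitian_spectral_diag_real Mh.
  by [].
have DD j : diag_mx D j j = D 0 j by rewrite mxE eqxx.
have cE : char_poly M = \prod_j ('X - (D 0 j)%:P).
  rewrite -(eq_bigr _ (fun j _ => congr1 (fun x => 'X - x%:P) (DD j))).
  rewrite -char_poly_trig ?diag_mx_is_trig// ME /char_poly.
  have -> : char_poly_mx (invmx P *m diag_mx D *m P) =
      map_mx polyC (invmx P) *m char_poly_mx (diag_mx D) *m map_mx polyC P.
    rewrite /char_poly_mx mulmxBr mulmxBl mul_mx_scalar -scalemxAl -!map_mxM.
    by rewrite mulVmx// map_mx1 scalemx1.
  rewrite !det_mulmx mulrAC -det_mulmx -map_mxM mulVmx// map_mx1 det1 mul1r.
  by [].
pose s := [seq complex.Re (D 0 j) | j : 'I_N].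
apply: (noP (sort >=%R s)); split.
  by apply: sort_sorted => x y; exact: ge_total.
rewrite (perm_big s) ?perm_sort//= /s big_map.
apply: (map_inj_poly (fmorph_inj toC)); first exact: rmorph0.
rewrite map_char_poly -/M cE rmorph_prod big_enum /=; apply: eq_bigr => j _.
rewrite map_polyXsubC; congr ('X - _%:P); exact: esym (DE j).
Qed.

End SpectralTheorem.

Section Probability.
Context {R : realType}.

(* Mutual independence of the subfamily (X i), i in D. *)
Definition independent_on d (T : measurableType d) (P : probability T R)
    (I : finType) (D : {set I}) (X : I -> {RV P >-> R}) :=
  forall (J : {set I}) (B : I -> set R), J \subset D ->
    (forall i, measurable (B i)) ->
    P (\bigcap_(i in [set` J]) (X i @^-1` B i)) =
    (\prod_(i in J) P (X i @^-1` B i))%E.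

Context {d : nat -> measure_display} {T : forall N, measurableType (d N)}.
Variable P : forall N, probability (T N) R.

(* The sets E N are required to be events, i.e. measurable. *)
Definition whp (E : forall N, set (T N)) :=
  (forall N, measurable (E N)) /\
  exists2 eta : R, 1 < eta &
    (fun N => fine (P N (~` E N)) : R^o) =O_\oo
    (fun N => expR (- (ln N%:R `^ eta)) : R^o).

Definition o_hp (Y Z : forall N, T N -> R) :=
  forall delta : R, 0 < delta ->
    whp (fun N => [set w | `|Y N w| <= delta * `|Z N w|]).

End Probability.

Section Model.
Context {R : realType} {d : measure_display} {T : measurableType d}.
Variables (P : probability T R) (N : nat).

Definition wigner (X : 'I_N -> 'I_N -> {RV P >-> R}) (w : T) : 'M[R]_N :=
  \matrix_(j, l) X (Order.min j l) (Order.max j l) w.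

Definition perturbed (k : nat) (alpha : 'I_k -> R) (h : 'I_k -> R -> R)
    (theta : R) (X : 'I_N -> 'I_N -> {RV P >-> R}) (w : T) : 'M[R]_N :=
  wigner X w + theta *: \sum_(i < k)
    alpha i *: (discretize N (h i) *m (discretize N (h i))^T).

End Model.

(* Main.v *)
(** By Courant-Fischer, testing on the span of e_0, .., e_i for the lower bound
    and on the orthogonal complement of e_0, .., e_(i-1) for the upper bound,
    the almost orthonormality of the e_j gives
    |lambda_i(A) - theta alpha_i| <= ||W|| + o(theta), so it suffices that
    ||W|| <= delta theta with high probability for every delta > 0.

    For this a crude trace moment bound is enough. A closed walk of length 2p
    contributes to E Tr W^(2p) only if it uses no edge exactly once; it then has
    at most p distinct edges, hence at most p + 1 distinct vertices. So
    E Tr W^(2p) <= N^(p+1) (p+1)^(2p+1) 2p (2p)^(2pB). With p of the order of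
    (log N)^2 the 2p-th root of this is O(sqrt N (log N)^(2(B+1))), which is
    negligible against theta since xi > 2 (B + 1), and Markov's inequality gives
    a failure probability O(exp(-(log N)^2)). *)
Require Import Defs.
From HB Require Import structures.
From mathcomp Require Import all_boot all_order all_algebra perm finmap.
From mathcomp Require Import all_classical all_reals all_analysis measurable_realfun.
From mathcomp Require Import ring lra.

Set Implicit Arguments.
Unset Strict Implicit.
Unset Printing Implicit Defensive.

Import Order.TTheory GRing.Theory Num.Theory.
Import numFieldNormedType.Exports.

Local Open Scope classical_set_scope.
Local Open Scope ring_scope.

(** * Spectral theorem for real symmetric matrices *)

Section LinearAlgebra.
Context {R : realType}.

(** Vectors are rows, as [eigenvalueP] and [kermx] act on the left; the norm stays squared to avoid
    roots. *)
Definition nrm2 n (x : 'rV[R]_n) : R := (x *m x^T) 0 0.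

Definition qform n (A : 'M[R]_n) (x : 'rV[R]_n) : R := (x *m A *m x^T) 0 0.

Lemma nrm2E n (x : 'rV[R]_n) : nrm2 x = \sum_j x 0 j ^+ 2.
Proof. by rewrite /nrm2 mxE; apply: eq_bigr => j _; rewrite mxE expr2. Qed.

Lemma nrm2_ge0 n (x : 'rV[R]_n) : 0 <= nrm2 x.
Proof. by rewrite nrm2E sumr_ge0// => j _; exact: sqr_ge0. Qed.

Lemma nrm2_eq0 n (x : 'rV[R]_n) : (nrm2 x == 0) = (x == 0).
Proof.
apply/eqP/eqP => [|->]; last by rewrite /nrm2 mul0mx mxE.
rewrite nrm2E => /eqP; rewrite psumr_eq0 => [/allP xE|j _]; last exact: sqr_ge0.
apply/rowP => j; have := xE j (mem_index_enum j).
by rewrite /= sqrf_eq0 mxE => /eqP.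
Qed.

Lemma nrm2_gt0 n (x : 'rV[R]_n) : (0 < nrm2 x) = (x != 0).
Proof. by rewrite lt_def nrm2_eq0 nrm2_ge0 andbT. Qed.

Lemma nrm2_orthonormal m n (Q : 'M[R]_(m, n)) (x : 'rV[R]_m) :
  Q *m Q^T = 1%:M -> nrm2 (x *m Q) = nrm2 x.
Proof. by move=> QQ; rewrite /nrm2 trmx_mul mulmxA -(mulmxA x) QQ mulmx1. Qed.

Lemma qform_diag n (Q : 'M[R]_n) (d x : 'rV[R]_n) :
  qform (Q^T *m diag_mx d *m Q) x = \sum_j d 0 j * (x *m Q^T) 0 j ^+ 2.
Proof.
rewrite /qform !mulmxA -(mulmxA (x *m Q^T *m diag_mx d)).
have -> : Q *m x^T = (x *m Q^T)^T by rewrite trmx_mul trmxK.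
move: (x *m Q^T) => y; rewrite mul_mx_diag mxE; apply: eq_bigr => j _.
by rewrite !mxE; ring.
Qed.

(* H is the reflection exchanging u and the first basis vector. *)
Lemma householder n (u : 'rV[R]_n.+1) : nrm2 u = 1 ->
  exists H : 'M[R]_n.+1, [/\ H^T = H, H *m H = 1%:M & delta_mx 0 0 *m H = u].
Proof.
move=> u1; set e : 'rV[R]_n.+1 := delta_mx 0 0.
have e1 : e *m e^T = 1%:M.
  by rewrite trmx_delta mul_delta_mx; apply/matrixP => i j; rewrite !ord1 !mxE.
have uu : u *m u^T = 1%:M by apply/matrixP => i j; rewrite !ord1 [LHS]u1 mxE.
(* If u = e, the vector v = u - e to reflect along vanishes, and the identity serves. *)
have [->|ue] := eqVneq u e.
  by exists 1%:M; split; rewrite ?trmx1 ?mulmx1.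
have [v vE] : exists v, v = u - e by exists (u - e).
pose b := u 0 0.
have eu : e *m u^T = b%:M.
  by apply/matrixP => i j; rewrite !ord1 -rowE !mxE.
have ue' : u *m e^T = b%:M by rewrite -[LHS]trmxK trmx_mul trmxK eu tr_scalar_mx.
have vv : v *m v^T = (2 - 2 * b)%:M.
  rewrite vE linearB/= mulmxBl !mulmxBr uu ue' eu e1.
  by rewrite -!raddfB/=; congr (_%:M); ring.
have ev : e *m v^T = (b - 1)%:M.
  by rewrite vE linearB/= mulmxBr eu e1 -raddfB.
have b1 : 1 - b != 0.
  apply: contraNneq ue => b1; rewrite -subr_eq0 -vE -nrm2_eq0 /nrm2 vv mxE eqxx.
  by apply/eqP; rewrite mulr1n -[LHS]mulr1 -[0](mulr0 2) -b1; ring.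
(* As |v|^2 = 2 - 2 b, [c] equals 2 / |v|^2, the coefficient of the reflection along v. *)
pose c := (1 - b)^-1.
exists (1%:M - c *: (v^T *m v)); split.
- by rewrite linearB/= trmx1 linearZ/= trmx_mul trmxK.
- rewrite mulmxBl mul1mx mulmxBr mulmx1 -scalemxAl -scalemxAr.
  rewrite mulmxA -(mulmxA v^T) vv mul_mx_scalar -scalemxAl !scalerA.
  have -> : c * (c * (2 - 2 * b)) = 2 * c by rewrite /c; field.
  rewrite opprB mulrDl mul1r scalerDl addrK.
  by rewrite subrK.
- rewrite mulmxBr mulmx1 -scalemxAr mulmxA ev mul_scalar_mx scalerA.
  have -> : c * (b - 1) = -1 by rewrite /c; field.
  by rewrite scaleN1r opprK vE addrC subrK.
Qed.

(** The characteristic polynomial splits over the reals with n + 1 roots, so at least one real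
    eigenvalue exists; its eigenvector is then normalized. *)
Lemma symmetric_eigenvector n (A : 'M[R]_n.+1) : A^T = A ->
  exists2 u : 'rV[R]_n.+1, nrm2 u = 1 & exists l, u *m A = l *: u.
Proof.
move=> AT; have [_ cE sz] := ordered_eigenvaluesP AT.
set s := ordered_eigenvalues A in cE sz.
have : root (char_poly A) s`_0.
  by rewrite cE root_prod_XsubC mem_nth// sz.
rewrite -eigenvalue_root_char => /eigenvalueP[v vA v0].
exists ((Num.sqrt (nrm2 v))^-1 *: v); last first.
  by exists s`_0; rewrite -scalemxAl vA !scalerA mulrC.
rewrite /nrm2 linearZ/= -scalemxAl -scalemxAr scalerA mxE -/(nrm2 v).
by rewrite -expr2 exprVn sqr_sqrtr ?nrm2_ge0// mulVf// nrm2_eq0.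
Qed.

(** Deflation: conjugation by a reflection taking a unit eigenvector to the first basis vector
    clears the first row off the diagonal, and by symmetry the first column. Induction diagonalizes
    the remaining block. *)
Lemma spectral_decomposition n (A : 'M[R]_n) : A^T = A ->
  exists (Q : 'M[R]_n) (d : 'rV[R]_n),
    Q *m Q^T = 1%:M /\ A = Q^T *m diag_mx d *m Q.
Proof.
elim: n A => [|n IH] A AT.
  by exists 1%:M, 0; split; apply/matrixP => -[].
have [u u1 [l uA]] := symmetric_eigenvector AT.
have [H [HT HH eH]] := householder u1.
have [C defC] : exists C : 'M[R]_(1 + n), C = H *m A *m H by eexists.
have CT : C^T = C by rewrite defC !trmx_mul HT AT mulmxA.
have eC : delta_mx 0 0 *m C = l *: delta_mx 0 0 :> 'rV_(1 + n).
  rewrite defC !mulmxA eH uA -scalemxAl; congr (_ *: _).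
  by rewrite -eH -mulmxA HH mulmx1.
have C0 j : C 0 j = l * (j == 0)%:R.
  by move/rowP/(_ j): eC; rewrite -rowE !mxE eqxx /= eq_sym.
have l0 : lshift n 0 = 0 :> 'I_(1 + n) by exact: val_inj.
have CE : C = block_mx l%:M 0 0 (drsubmx C).
  rewrite -[LHS](@submxK _ 1 n 1 n); congr block_mx.
  - by apply/matrixP => i j; rewrite !ord1 !mxE l0 C0 mulr1.
  - by apply/matrixP => i j; rewrite !ord1 !mxE l0 C0 mulr0.
  - by apply/matrixP => i j; rewrite !ord1 !mxE -CT mxE l0 C0 mulr0.
have CdT : (drsubmx C)^T = drsubmx C by rewrite trmx_drsub CT.
have [Q [d [QQ CdE]]] := IH _ CdT.
pose K : 'M[R]_(1 + n) := block_mx 1%:M 0 0 Q.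
have KT : K^T = block_mx 1%:M 0 0 Q^T by rewrite tr_block_mx !trmx0 trmx1.
have KK : K *m K^T = 1%:M.
  rewrite KT mulmx_block !mulmx0 !mul0mx !mulmx1 QQ !addr0 add0r.
  by rewrite -scalar_mx_block.
have KC : C = K^T *m diag_mx (row_mx l%:M d) *m K.
  rewrite CE diag_mx_row KT !mulmx_block.
  rewrite !mulmx0 !mul0mx !mulmx1 !mul1mx !(addr0, add0r) ?(mul0mx, mulmx0, addr0) -CdE.
  by congr block_mx; apply/matrixP => i j; rewrite !ord1 !mxE eqxx.
exists (K *m H), (row_mx l%:M d); split.
  by rewrite trmx_mul HT mulmxA -(mulmxA _ H H) HH mulmx1.
have -> : A = H *m C *m H by rewrite defC !mulmxA HH mul1mx -mulmxA HH mulmx1.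
by rewrite trmx_mul HT KC !mulmxA.
Qed.

Lemma char_poly_orthogonal_diag n (Q : 'M[R]_n) (d : 'rV[R]_n) :
  Q *m Q^T = 1%:M ->
  char_poly (Q^T *m diag_mx d *m Q) = \prod_j ('X - (d 0 j)%:P).
Proof.
move=> QQ; have QQ' := mulmx1C QQ.
have dE j : d 0 j = diag_mx d j j by rewrite mxE eqxx.
under [RHS]eq_bigr => j _ do rewrite dE.
rewrite -char_poly_trig ?diag_mx_is_trig// /char_poly.
have -> : char_poly_mx (Q^T *m diag_mx d *m Q) =
    map_mx polyC Q^T *m char_poly_mx (diag_mx d) *m map_mx polyC Q.
  rewrite /char_poly_mx mulmxBr mulmxBl mul_mx_scalar -scalemxAl -!map_mxM.
  by rewrite QQ' map_mx1 scalemx1.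
by rewrite !det_mulmx mulrAC -det_mulmx -map_mxM QQ' map_mx1 det1 mul1r.
Qed.

(** A polynomial determines its linear factors up to order, so any orthogonal diagonalization lists
    the ordered eigenvalues up to a permutation, which is then applied to the rows of Q. *)
Lemma eigval_diagonalization n (A : 'M[R]_n) : A^T = A ->
  exists2 Q : 'M[R]_n, Q *m Q^T = 1%:M &
    A = Q^T *m diag_mx (\row_j eigval A j) *m Q.
Proof.
move=> AT; have [_ cE sz] := ordered_eigenvaluesP AT.
have [Q [d [QQ AE]]] := spectral_decomposition AT.
have /tuple_permP[s sE] : perm_eq (ordered_eigenvalues A) [tuple d 0 j | j < n].
  apply: prod_XsubC_eq; rewrite -cE [in LHS]AE char_poly_orthogonal_diag//.
  by rewrite big_tuple; apply: eq_bigr => j _; rewrite tnth_mktuple.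
have eE (j : 'I_n) : eigval A j = d 0 (s j).
  by rewrite /eigval sE nth_mktuple tnth_mktuple.
exists (row_perm s Q).
  apply/matrixP => a b; move/matrixP/(_ (s a) (s b)): QQ.
  rewrite !mxE (inj_eq perm_inj) => <-; apply: eq_bigr => j _.
  by rewrite !mxE.
rewrite [LHS]AE !mul_mx_diag; apply/matrixP => a b; rewrite !mxE.
rewrite (reindex_inj (@perm_inj _ s)); apply: eq_bigr => j _.
by rewrite !mxE eE.
Qed.

End LinearAlgebra.

(** * Courant-Fischer bounds *)

Section CourantFischer.
Context {R : realType}.

Lemma tr_orthogonal n (Q : 'M[R]_n) : Q *m Q^T = 1%:M -> Q^T *m Q^T^T = 1%:M.
Proof. by rewrite trmxK => /mulmx1C. Qed.

(** The dimension count that yields the test vector in both Courant-Fischer bounds. *)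
Lemma nontrivial_left_kernel m (M : 'M[R]_(m.+1, m)) :
  exists2 y : 'rV[R]_m.+1, y != 0 & y *m M = 0.
Proof.
have : kermx M != 0.
  by rewrite kermx_eq0 /row_free neq_ltn ltnS rank_leq_col.
by case/rowV0Pn => y /sub_kermxP yM y0; exists y.
Qed.

Lemma eigval_nonincreasing n (A : 'M[R]_n) i j : A^T = A ->
  (i <= j < n)%N -> eigval A j <= eigval A i.
Proof.
move=> AT /andP[ij jn]; have [ss _ sz] := ordered_eigenvaluesP AT.
apply: (sorted_leq_nth (rev_trans le_trans) _ 0 ss) => //=.
- by rewrite inE sz (leq_ltn_trans ij).
- by rewrite inE sz.
Qed.

(** The rows of V are the eigenvectors of index 0, .., i; on their span only eigenvalues at least
    [eigval A i] enter the form. *)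
Lemma top_eigenspace n (A : 'M[R]_n) (i : 'I_n) : A^T = A ->
  exists2 V : 'M[R]_(i.+1, n), V *m V^T = 1%:M &
    forall y, eigval A i * nrm2 (y *m V) <= qform A (y *m V).
Proof.
move=> AT; have [Q QQ AE] := eigval_diagonalization AT.
pose V := rowsub (widen_ord (ltn_ord i)) Q.
have VQ : V *m Q^T = rowsub (widen_ord (ltn_ord i)) 1%:M.
  by rewrite /V mul_rowsub_mx QQ.
have VV : V *m V^T = 1%:M.
  rewrite {2}/V trmx_mxsub mulmx_colsub VQ.
  apply/matrixP => a b; rewrite !mxE; congr (_%:R).
exists V => // y.
rewrite [in leRHS]AE qform_diag -(nrm2_orthonormal _ (tr_orthogonal QQ)).
  rewrite nrm2E mulr_sumr; apply: ler_sum => j _; rewrite mxE.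
have [ji|ij] := leqP j i.
  by rewrite ler_wpM2r ?sqr_ge0// eigval_nonincreasing// ji /=.
rewrite -mulmxA VQ.
suff -> : (y *m rowsub (widen_ord (ltn_ord i)) 1%:M) 0 j = 0.
  by rewrite expr0n !mulr0.
rewrite mxE big1// => a _; rewrite !mxE.
by rewrite -val_eqE/= ltn_eqF ?mulr0// (leq_trans (ltn_ord a)).
Qed.

(** Max-min half of Courant-Fischer. Injectivity of y |-> y V replaces orthonormality of the rows,
    so that almost orthonormal spikes can be used as rows. *)
Lemma eigval_ge n (A : 'M[R]_n) (i : 'I_n) (V : 'M[R]_(i.+1, n)) (c : R) :
  A^T = A ->
  (forall y, y != 0 -> y *m V != 0 /\ c * nrm2 (y *m V) <= qform A (y *m V)) ->
  c <= eigval A i.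
Proof.
move=> AT HV; have [Q QQ AE] := eigval_diagonalization AT.
(* The vector y V is orthogonal to the first i eigenvectors, so its form is at most [eigval A i]
   times its squared norm. *)
have [y y0 yM] := nontrivial_left_kernel
  (colsub (widen_ord (ltnW (ltn_ord i))) (V *m Q^T)).
have [x0] := HV _ y0; rewrite {1}AE qform_diag => cq.
rewrite -(ler_pM2r (etrans (nrm2_gt0 _) x0)) (le_trans cq)//.
rewrite -(nrm2_orthonormal (y *m V) (tr_orthogonal QQ)) nrm2E mulr_sumr.
apply: ler_sum => j _; rewrite mxE.
have [ij|ji] := leqP i j.
  by rewrite ler_wpM2r ?sqr_ge0// eigval_nonincreasing// ij /=.
suff -> : (y *m V *m Q^T) 0 j = 0 by rewrite expr0n !mulr0.
move/rowP/(_ (Ordinal ji)): yM; rewrite mulmx_colsub mulmxA mxE [RHS]mxE => <-.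
by congr (_ 0 _); exact: val_inj.
Qed.

(** Min-max half: the top eigenspace of dimension i + 1 contains a nonzero vector orthogonal to the
    i rows of E. *)
Lemma eigval_le n (A : 'M[R]_n) (i : 'I_n) (E : 'M[R]_(i, n)) (c : R) :
  A^T = A ->
  (forall x, x *m E^T = 0 -> qform A x <= c * nrm2 x) ->
  eigval A i <= c.
Proof.
move=> AT HE; have [V VV HV] := top_eigenspace i AT.
have [y y0] := nontrivial_left_kernel (V *m E^T).
rewrite mulmxA => /HE qc.
have y1 : 0 < nrm2 (y *m V) by rewrite nrm2_orthonormal// nrm2_gt0.
by rewrite -(ler_pM2r y1) (le_trans (HV y)).
Qed.

(** One side of Weyl's inequality: C is tested on the top eigenspace of A. *)
Lemma eigval_perturb n (A C : 'M[R]_n) (i : 'I_n) (t : R) :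
  A^T = A -> C^T = C ->
  (forall x, qform A x <= qform C x + t * nrm2 x) ->
  eigval A i <= eigval C i + t.
Proof.
move=> AT CT AC; have [V VV HV] := top_eigenspace i AT.
rewrite -lerBlDr; apply: (eigval_ge (V := V) CT) => y y0; split.
  by rewrite -nrm2_gt0 (nrm2_orthonormal _ VV) nrm2_gt0.
by rewrite mulrBl lerBlDr (le_trans (HV y))// AC.
Qed.

Lemma symmetric_powE n (A Q : 'M[R]_n) (d : 'rV[R]_n) m :
  Q *m Q^T = 1%:M -> A = Q^T *m diag_mx d *m Q ->
  iter m (mulmx A) 1%:M = Q^T *m diag_mx (\row_j d 0 j ^+ m) *m Q.
Proof.
move=> QQ AE; elim: m => [|m IH] /=.
  have -> : diag_mx (\row_j d 0 j ^+ 0) = 1%:M.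
    by apply/matrixP => i j; rewrite !mxE expr0.
  by rewrite mulmx1 mulmx1C.
rewrite IH AE !mulmxA -(mulmxA (Q^T *m diag_mx d)) QQ mulmx1.
rewrite -(mulmxA Q^T) mulmx_diag; congr (_ *m diag_mx _ *m _).
by apply/rowP => j; rewrite !mxE exprS.
Qed.

(** The trace is the sum of the 2p-th powers of the eigenvalues, all nonnegative, so it dominates
    each of them. *)
Lemma qform_le_trace n (A : 'M[R]_n) (p : nat) (t : R) :
  A^T = A -> 0 <= t -> (0 < p)%N ->
  \tr (iter p.*2 (mulmx A) 1%:M) <= t ^+ p.*2 ->
  forall x, `|qform A x| <= t * nrm2 x.
Proof.
move=> AT t0 p0 trA x; have [Q [d [QQ AE]]] := spectral_decomposition AT.
move: trA; rewrite (symmetric_powE _ QQ AE) -mulmxA mxtrace_mulC -mulmxA QQ mulmx1.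
rewrite mxtrace_diag => trA.
have dt j : `|d 0 j| <= t.
  rewrite -(@ler_pXn2r _ p.*2) ?nnegrE ?double_gt0//.
  apply: le_trans trA; rewrite (bigD1 j)//= mxE.
  have p2 (y : R) : 0 <= y ^+ p.*2 by rewrite -muln2 exprM sqr_ge0.
  by rewrite -normrX ger0_norm// lerDl sumr_ge0// => a _; rewrite mxE.
rewrite [in leLHS]AE qform_diag (le_trans (ler_norm_sum _ _ _))//.
rewrite -(nrm2_orthonormal x (tr_orthogonal QQ)) nrm2E mulr_sumr.
apply: ler_sum => j _; rewrite normrM ler_pM// ger0_norm ?sqr_ge0//.
Qed.

End CourantFischer.

(** * Low-rank perturbations *)

Section LowRankPerturbation.
Context {R : realType}.

(** Entrywise |y_a y_b| <= (y_a^2 + y_b^2) / 2, and the double sum of the right side is m |y|^2. *)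
Lemma bilinear_bound m (D : 'M[R]_m) (eps : R) (y : 'rV[R]_m) :
  (forall a b, `|D a b| <= eps) -> `|qform D y| <= m%:R * eps * nrm2 y.
Proof.
move=> De; rewrite /qform mxE (le_trans (ler_norm_sum _ _ _))//.
have -> : m%:R * eps * nrm2 y =
    \sum_(b < m) \sum_(a < m) eps * ((y 0 a ^+ 2 + y 0 b ^+ 2) / 2).
  under eq_bigr => b _ do rewrite -mulr_sumr -mulr_suml big_split/= sumr_const
    card_ord -nrm2E.
  rewrite -mulr_sumr -mulr_suml big_split/= sumr_const card_ord sumrMnl -nrm2E.
  by rewrite -mulr_natl; field.
apply: ler_sum => b _; rewrite !mxE mulr_suml (le_trans (ler_norm_sum _ _ _))//.
apply: ler_sum => a _; rewrite !normrM.
rewrite mulrAC mulrC ler_pM ?mulr_ge0//.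
rewrite -[y 0 a ^+ 2]real_normK ?num_real// -[y 0 b ^+ 2]real_normK ?num_real//.
have := sqr_ge0 (`|y 0 a| - `|y 0 b|); lra.
Qed.

Lemma gram_bound m n (V : 'M[R]_(m, n)) (eps : R) (y : 'rV[R]_m) :
  (forall a b, `|(V *m V^T) a b - (a == b)%:R| <= eps) ->
  `|nrm2 (y *m V) - nrm2 y| <= m%:R * eps * nrm2 y.
Proof.
move=> Ve; have <- : qform (V *m V^T - 1%:M) y = nrm2 (y *m V) - nrm2 y.
  rewrite /qform /nrm2 mulmxBr mulmx1 mulmxBl trmx_mul !mulmxA.
  by rewrite mxE; congr (_ + _); rewrite mxE.
by apply: bilinear_bound => a b; rewrite 2!mxE; have := Ve a b; rewrite !mxE.
Qed.

(** Bessel's inequality for almost orthonormal rows: with c = x V^T and s = 1 / (1 + m eps), expand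
    |x - s c V|^2 >= 0 and bound |c V|^2 by [gram_bound]. *)
Lemma near_bessel m n (V : 'M[R]_(m, n)) (eps : R) (x : 'rV[R]_n) :
  (forall a b, `|(V *m V^T) a b - (a == b)%:R| <= eps) -> 0 <= eps ->
  nrm2 (x *m V^T) <= (1 + m%:R * eps) * nrm2 x.
Proof.
move=> Ve e0; set c := x *m V^T; set g := m%:R * eps.
have g0 : 0 <= g by rewrite mulr_ge0.
have : `|nrm2 (c *m V) - nrm2 c| <= g * nrm2 c by exact: gram_bound.
rewrite ler_norml => /andP[_ cV].
have s0 : 0 < 1 + g by rewrite ltr_pwDl.
pose s := (1 + g)^-1.
have : nrm2 (x - s *: (c *m V)) = nrm2 x - 2 * s * nrm2 c + s ^+ 2 * nrm2 (c *m V).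
  have xT : (x - s *: (c *m V))^T = x^T - s *: (c *m V)^T by rewrite linearB linearZ.
  rewrite /nrm2 xT mulmxBl !mulmxBr -!scalemxAl -!scalemxAr scalerA.
  have -> : x *m (c *m V)^T = c *m c^T.
    by rewrite trmx_mul mulmxA.
  have -> : c *m V *m x^T = c *m c^T.
    by rewrite -mulmxA; congr (_ *m _); rewrite trmx_mul trmxK.
  by move: (_ *m _) (_ *m _) (_ *m _) => X Y Z; rewrite !mxE; ring.
move: (nrm2_ge0 (x - s *: (c *m V))) => /[swap] ->.
have s2 : s ^+ 2 * nrm2 (c *m V) <= s * nrm2 c.
  rewrite expr2 -mulrA ler_pM2l ?invr_gt0// /s mulrC ler_pdivrMr//.
  by rewrite mulrC; lra.
move=> q; rewrite mulrC -ler_pdivrMr// mulrC -/s; lra.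
Qed.

Lemma qform_spiked n k (W : 'M[R]_n) (th : R) (alpha : 'I_k -> R)
    (e : 'I_k -> 'cV[R]_n) (x : 'rV[R]_n) :
  qform (W + th *: \sum_(a < k) alpha a *: (e a *m (e a)^T)) x =
  qform W x + th * \sum_(a < k) alpha a * (x *m e a) 0 0 ^+ 2.
Proof.
rewrite /qform mulmxDr mulmxDl mxE; congr (_ + _).
rewrite -scalemxAr -scalemxAl mxE; congr (_ * _).
rewrite mulmx_sumr mulmx_suml summxE; apply: eq_bigr => a _.
rewrite -scalemxAr -scalemxAl mxE; congr (_ * _).
rewrite (mulmxA x) -(mulmxA (x *m e a)) -trmx_mul mxE big_ord1 [X in _ * X]mxE expr2.
by [].
Qed.

Lemma spiked_eigval n k (W : 'M[R]_n) (th t eps : R) (alpha : 'I_k -> R)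
    (e : 'I_k -> 'cV[R]_n) (i : 'I_k) :
  W^T = W -> 0 < th -> (i < n)%N ->
  (forall a, 0 < alpha a) ->
  (forall a b : 'I_k, (a < b)%N -> alpha b < alpha a) ->
  (forall x, `|qform W x| <= t * nrm2 x) ->
  (forall a b, `|((e a)^T *m e b) 0 0 - (a == b)%:R| <= eps) ->
  k%:R * eps <= 1 / 2 ->
  `|eigval (W + th *: \sum_(a < k) alpha a *: (e a *m (e a)^T)) i - th * alpha i|
    <= t + 2 * (k%:R * eps) * (th * alpha i).
Proof.
move=> WT th0 ilt a0 adec Wt eG ke; set A := W + _.
have AT : A^T = A.
  rewrite linearD/= WT linearZ/= linear_sum/=; congr (_ + _ *: _).
  by apply: eq_bigr => a _; rewrite linearZ/= trmx_mul trmxK.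
have eps0 : 0 <= eps by rewrite (le_trans _ (eG i i)).
set g := k%:R * eps in ke *; have g0 : 0 <= g by rewrite mulr_ge0.
have adec' (a b : 'I_k) : (a <= b)%N -> alpha b <= alpha a.
  by rewrite leq_eqVlt => /predU1P[/val_inj->//|/adec/ltW].
have tha0 : 0 <= th * alpha i by rewrite mulr_ge0// ltW.
pose io := Ordinal ilt.
rewrite ler_distl; apply/andP; split.
(* Lower bound, on the span of e_0, .., e_i. *)
- pose V : 'M[R]_(i.+1, n) := \matrix_(a, b) e (widen_ord (ltn_ord i) a) b 0.
  have VE (x : 'rV_n) a : (x *m V^T) 0 a = (x *m e (widen_ord (ltn_ord i) a)) 0 0.
    by rewrite !mxE; apply: eq_bigr => b _; rewrite !mxE.
  have VG a b : `|(V *m V^T) a b - (a == b)%:R| <= eps.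
    have := eG (widen_ord (ltn_ord i) a) (widen_ord (ltn_ord i) b).
    rewrite -val_eqE/= val_eqE; congr (`| _ - _ | <= _); rewrite !mxE.
    by apply: eq_bigr => c _; rewrite !mxE.
  apply: (@eigval_ge _ _ A io V) => // y y0.
  have iek : i.+1%:R * eps <= g by rewrite ler_wpM2r// ler_nat.
  have y1 : 0 < nrm2 y by rewrite nrm2_gt0.
  have : `|nrm2 (y *m V) - nrm2 y| <= g * nrm2 y.
    by rewrite (le_trans (gram_bound y VG))// ler_pM2r.
  rewrite ler_norml => /andP[yV1 yV2].
  have gy : g * nrm2 y <= 1 / 2 * nrm2 y by rewrite ler_pM2r.
  have x1 : 0 < nrm2 (y *m V) by lra.
  split; first by rewrite -nrm2_gt0.
  (* With [D] the Gram matrix minus the identity, |y (1 + D)|^2 = |y V|^2 + y D y^T + |y D|^2. The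
     last square is dropped, and |y|^2 <= 2 |y V|^2, valid as g <= 1/2, bounds the middle term by 2
     g |y V|^2; hence the factor 2 in the conclusion. *)
  have [D DE] : exists D, D = V *m V^T - 1%:M by eexists.
  have yG : nrm2 (y *m V *m V^T) = nrm2 (y *m V) + qform D y + nrm2 (y *m D).
    have -> : y *m V *m V^T = y + y *m D.
      by rewrite DE -mulmxA mulmxBr mulmx1 addrC subrK.
    have -> : nrm2 (y *m V) = nrm2 y + qform D y.
      rewrite DE /qform /nrm2 mulmxBr mulmx1 mulmxBl trmx_mul !mulmxA.
      by rewrite [X in _ = _ + X]mxE [X in _ + (_ + X)]mxE; ring.
    have DT : D^T = D by rewrite DE linearB/= trmx_mul trmxK trmx1.
    have yDT : (y + y *m D)^T = y^T + D *m y^T by rewrite linearD/= trmx_mul DT.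
    rewrite /nrm2 /qform yDT trmx_mul DT mulmxDl !mulmxDr !mulmxA.
    by move: (_ *m _) (_ *m _) (_ *m _) => X Y Z; rewrite !mxE; ring.
  have : `|qform D y| <= g * nrm2 y.
    apply: (le_trans (bilinear_bound (eps := eps) y _)); last by rewrite ler_pM2r.
    by move=> a b; have := VG a b; rewrite DE !mxE.
  rewrite ler_norml => /andP[qD _].
  have xV : (1 - 2 * g) * nrm2 (y *m V) <= nrm2 (y *m V *m V^T).
    rewrite yG; have := nrm2_ge0 (y *m D).
    have : g * nrm2 y <= g * (2 * nrm2 (y *m V)) by apply: ler_wpM2l => //; lra.
    lra.
  set x := y *m V in x1 xV *.
  (* Spikes beyond i contribute nonnegative terms and are dropped; the others have alpha_a >=
     alpha_i. *)
  have : th * alpha i * nrm2 (x *m V^T) <=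
      th * \sum_(a < k) alpha a * (x *m e a) 0 0 ^+ 2.
    rewrite -mulrA ler_pM2l// nrm2E mulr_sumr.
    rewrite (bigID (fun a : 'I_k => a < i.+1)%N)/= ler_wpDr//.
      by rewrite sumr_ge0// => a _; rewrite mulr_ge0 ?sqr_ge0// ltW.
    rewrite (big_ord_narrow (ltn_ord i)).
    apply: ler_sum => a _; rewrite VE ler_wpM2r ?sqr_ge0//.
    by rewrite adec'//= -ltnS.
  have : th * alpha i * ((1 - 2 * g) * nrm2 x) <= th * alpha i * nrm2 (x *m V^T).
    by rewrite ler_wpM2l.
  rewrite /A qform_spiked; have := Wt x; rewrite ler_norml => /andP[Wx _].
  lra.
(* Upper bound: orthogonality to e_0, .., e_(i-1) kills the larger spikes, the remaining weights are
   at most alpha_i, and [near_bessel] is applied to all k spikes. *)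
- pose E : 'M[R]_(i, n) := \matrix_(a, b) e (widen_ord (ltnW (ltn_ord i)) a) b 0.
  apply: (@eigval_le _ _ A io E) => // x xE.
  pose V : 'M[R]_(k, n) := \matrix_(a, b) e a b 0.
  have VE a : (x *m V^T) 0 a = (x *m e a) 0 0.
    by rewrite !mxE; apply: eq_bigr => b _; rewrite !mxE.
  have VG a b : `|(V *m V^T) a b - (a == b)%:R| <= eps.
    have := eG a b; congr (`| _ - _ | <= _); rewrite !mxE.
    by apply: eq_bigr => c _; rewrite !mxE.
  have : th * \sum_(a < k) alpha a * (x *m e a) 0 0 ^+ 2 <=
      th * alpha i * nrm2 (x *m V^T).
    rewrite -mulrA ler_pM2l// nrm2E mulr_sumr.
    apply: ler_sum => a _; rewrite VE; have [ia|ai] := leqP i a.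
      by rewrite ler_wpM2r ?sqr_ge0// adec'.
    suff -> : (x *m e a) 0 0 = 0 by rewrite expr0n !mulr0.
    move/rowP/(_ (Ordinal ai)): xE; rewrite [RHS]mxE => xE0.
    rewrite -[RHS]xE0 !mxE; apply: eq_bigr => b _.
    by rewrite !mxE; congr (_ * e _ _ _); exact: val_inj.
  have : th * alpha i * nrm2 (x *m V^T) <= th * alpha i * ((1 + g) * nrm2 x).
    by rewrite ler_wpM2l// near_bessel.
  (* Slack between the factor 1 + g obtained here and the claimed 1 + 2 g. *)
  have : 0 <= th * alpha i * g * nrm2 x by exact: mulr_ge0 (mulr_ge0 tha0 g0) (nrm2_ge0 x).
  rewrite /A qform_spiked; have := Wt x; rewrite ler_norml => /andP[_ Wx].
  lra.
Qed.

End LowRankPerturbation.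

(** * Walks and traces of powers *)

Section Walks.

(** The ordered representative of an unordered edge, matching the indexing in [wigner]: an edge
    walked in either direction gives the same variable. *)
Definition sym_edge (n : nat) (e : 'I_n * 'I_n) : 'I_n * 'I_n :=
  (Order.min e.1 e.2, Order.max e.1 e.2).

Definition walk_edges n (t : seq 'I_n) : seq ('I_n * 'I_n) :=
  [seq sym_edge e | e <- zip t (behead t)].

Lemma sym_edge_mem n (e : 'I_n * 'I_n) :
  (sym_edge e == e) || (sym_edge e == (e.2, e.1)).
Proof.
by case: e => a b; rewrite /sym_edge/= minEle maxEle; case: ifP; rewrite eqxx ?orbT.
Qed.

Lemma walk_edges_vertices n (t : seq 'I_n) e :
  e \in walk_edges t -> (e.1 \in t) && (e.2 \in t).
Proof.
elim: t => // x [|y s] IH //.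
have -> : walk_edges [:: x, y & s] = sym_edge (x, y) :: walk_edges (y :: s) by [].
rewrite inE => /predU1P[->|/IH/andP[e1 e2]]; last first.
  by rewrite in_cons e1 [e.2 \in _]in_cons e2 !orbT.
by have /orP[/eqP->|/eqP->] := sym_edge_mem (x, y); rewrite !inE !eqxx ?orbT.
Qed.

(* The walk is read backwards: a vertex not visited later is left along an edge
   not used later. *)
Lemma walk_vertices n (t : seq 'I_n) :
  (size (undup t) <= (size (undup (walk_edges t))).+1)%N.
Proof.
elim: t => // x [|y s] IH //.
have -> : walk_edges [:: x, y & s] = sym_edge (x, y) :: walk_edges (y :: s) by [].
rewrite [undup (x :: _)]/= [undup (sym_edge _ :: _)]/= -/(undup (y :: s)).
case: (boolP (x \in y :: s)) => xs.
  rewrite -[X in size X]/(undup (y :: s)) (leq_trans IH)// ltnS.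
  by case: ifP => //= _; exact: leqnSn.
case: ifPn => [|_].
  move=> /walk_edges_vertices/andP[e1 e2]; exfalso; move: xs.
  have /orP[/eqP E|/eqP E] := sym_edge_mem (x, y); rewrite {}E /= in e1 e2.
    by rewrite e1.
  by rewrite e2.
by rewrite -[X in size X]/(x :: undup (y :: s)) /= ltnS.
Qed.

Lemma size_undup_double (T : eqType) (s : seq T) :
  (forall x, x \in s -> (2 <= count_mem x s)%N) -> ((size (undup s)).*2 <= size s)%N.
Proof.
have -> : size s = (\sum_(x <- undup s) count_mem x s)%N.
  rewrite -sum1_size -[LHS]big_undup_iterop_count; apply: eq_bigr => x _.
  by case: (count_mem x s) => // m; elim: m => // m; rewrite /iterop/= => ->.
move=> s2; rewrite -muln2 -sum1_size big_distrl/=.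
rewrite big_seq [leqRHS]big_seq; apply: leq_sum => x; rewrite mem_undup.
by rewrite mul1n; exact: s2.
Qed.

(** There are 2p steps; if no edge is used exactly once, at most p edges are distinct. *)
Lemma walk_few_vertices n (t : seq 'I_n) p : size t = p.*2.+1 ->
  (forall e, e \in walk_edges t -> count_mem e (walk_edges t) != 1%N) ->
  (size (undup t) <= p.+1)%N.
Proof.
move=> st c1; rewrite (leq_trans (walk_vertices t))// ltnS -leq_double.
have <- : size (walk_edges t) = p.*2.
  by rewrite size_map size_zip size_behead st/= (minn_idPr (leqnSn _)).
apply: size_undup_double => e et; have := c1 e et.
by rewrite -has_pred1 has_count in et; case: count et => [|[]].
Qed.

(* A tuple with at most q values factors through 'I_q. *)
Lemma card_few_values (T : finType) (m q : nat) :
  (#|[set t : m.+1.-tuple T | (size (undup t) <= q)%N]%SET| <= #|T| ^ q * q ^ m.+1)%N.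
Proof.
pose f (gs : q.-tuple T * m.+1.-tuple 'I_q) := map_tuple (tnth gs.1) gs.2.
have -> : (#|T| ^ q * q ^ m.+1 = #|[set: q.-tuple T * m.+1.-tuple 'I_q]%SET|)%N.
  by rewrite cardsT card_prod !card_tuple card_ord.
apply: leq_trans (leq_imset_card f _); apply: subset_leq_card.
apply/fintype.subsetP => t; rewrite inE => tq.
have tu x : x \in t -> (index x (undup t) < q)%N.
  by move=> xt; rewrite (leq_trans _ tq)// index_mem mem_undup.
(* [x0] pads [undup t] to length q; the padding is never read when [t] is rebuilt. *)
pose x0 := thead t.
apply/imsetP; exists ([tuple nth x0 (undup t) i | i < q],
   [tuple Ordinal (tu _ (mem_tnth j t)) | j < m.+1]) => //.
apply: eq_from_tnth => j; rewrite tnth_map !tnth_mktuple /= nth_index//.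
by rewrite mem_undup mem_tnth.
Qed.

Lemma big_tuple_cons (V : nmodType) (T : finType) m (F : m.+1.-tuple T -> V) :
  \sum_t F t = \sum_x \sum_(s : m.-tuple T) F [tuple of x :: s].
Proof.
rewrite pair_bigA/=; rewrite (reindex (fun p : T * m.-tuple T => [tuple of p.1 :: p.2])) //=.
exists (fun t => (thead t, [tuple of behead t])) => [[x s] _|t _]/=.
  by congr pair; apply: val_inj.
by rewrite -tuple_eta.
Qed.

(** The endpoint is imposed by an indicator, so the sum runs over all tuples and induction peels off
    the first step. *)
Lemma walk_power (R : comPzRingType) n (W : 'M[R]_n) m x y :
  iter m (mulmx W) 1%:M x y =
  \sum_(s : m.-tuple 'I_n)
    (last x s == y)%:R * \prod_(e <- zip (x :: s) s) W e.1 e.2.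
Proof.
elim: m x => [|m IH] x /=.
  rewrite (bigD1 [tuple])//= [X in _ + X]big1 => [|s /eqP s0]; last first.
    by case: s0; exact: tuple0.
  by rewrite big_nil mulr1 addr0 mxE.
rewrite mxE big_tuple_cons; apply: eq_bigr => z _; rewrite IH mulr_sumr.
by apply: eq_bigr => s _; rewrite /= big_cons/= mulrCA.
Qed.

Lemma trace_power (R : comPzRingType) n (X : 'I_n -> 'I_n -> R) (W : 'M[R]_n) m :
  (forall a b, W a b = X (Order.min a b) (Order.max a b)) ->
  \tr (iter m (mulmx W) 1%:M) =
  \sum_(t : m.+1.-tuple 'I_n)
    (last (thead t) t == thead t)%:R * \prod_(e <- walk_edges t) X e.1 e.2.
Proof.
move=> WX; rewrite big_tuple_cons; apply: eq_bigr => x _; rewrite walk_power.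
apply: eq_bigr => s _; rewrite theadE /=; congr (_ * _).
by rewrite /walk_edges big_map; apply: eq_bigr => e _; rewrite WX.
Qed.

End Walks.

(** * Expectation of products of independent variables *)

Section Independence.
Context {R : realType} {d : measure_display} {T : measurableType d}.
Variable P : probability T R.
Import HBNNSimple.

Local Open Scope ereal_scope.

(** The absolute value makes every summand nonnegative without reference to the range, as exchanging
    sum and integral requires. *)
Lemma nnsfun_absE (h : {nnsfun R >-> R}) x :
  h x = (\sum_(y <- fset_set (range h)) `|y| * \1_(h @^-1` [set y]) x)%R.
Proof.
rewrite [LHS]fimfunE fsbig_finite//=; apply: eq_bigr => y _.
rewrite indicE; have [|_] := boolP (x \in _); last by rewrite !mulr0.
by rewrite inE => /= <-; rewrite ger0_norm.
Qed.

Lemma integral_comp_nnsfun (h : {nnsfun R >-> R}) (f Y : T -> R) :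
  measurable_fun setT f -> measurable_fun setT Y -> (forall w, 0 <= Y w)%R ->
  \int[P]_w (h (f w) * Y w)%:E =
  \sum_(y <- fset_set (range h))
    `|y|%:E * \int[P]_w (\1_(h @^-1` [set y]) (f w) * Y w)%:E.
Proof.
move=> mf mY Y0.
have m1 y : measurable_fun setT (fun w => \1_(h @^-1` [set y]) (f w) * Y w)%R.
  apply: measurable_funM => //; apply: (measurableT_comp _ mf).
  exact: measurable_indic.
under eq_integral => w _.
  rewrite nnsfun_absE mulr_suml -sumEFin.
  under eq_bigr => y _ do rewrite -mulrA EFinM.
  over.
rewrite ge0_integral_sum//.
- apply: eq_bigr => y _; rewrite ge0_integralZl_EFin//.
  + by move=> w _; rewrite lee_fin mulr_ge0.
  + exact/measurable_EFinP.
- by move=> y; apply/measurable_funeM/measurable_EFinP.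
- by move=> y w _; rewrite mule_ge0// lee_fin mulr_ge0.
Qed.


Lemma cvg_integral_comp_approx (f Z : T -> R) (g' : R -> R)
    (mg : measurable_fun setT (EFin \o g')) :
  measurable_fun setT f -> measurable_fun setT Z -> (forall w, 0 <= Z w)%R ->
  (forall x, 0 <= g' x)%R ->
  \int[P]_w (nnsfun_approx measurableT mg n (f w) * Z w)%:E @[n --> \oo] -->
  \int[P]_w (g' (f w) * Z w)%:E.
Proof.
move=> mf mZ Z0 g0.
have G0 (x : R) : [set: R] x -> 0 <= (EFin \o g') x by rewrite /= lee_fin.
have GP w : (nnsfun_approx measurableT mg n (f w) * Z w)%:E @[n --> \oo] -->
    (g' (f w) * Z w)%:E.
  rewrite EFinM; under eq_fun do rewrite EFinM.
  apply: cvgeZr => //.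
  exact: (cvg_nnsfun_approx measurableT mg G0).
rewrite (_ : (fun w => (g' (f w) * Z w)%:E) = (fun w =>
    limn (fun n => (nnsfun_approx measurableT mg n (f w) * Z w)%:E))); last first.
  by apply/funext => w; exact/esym/cvg_lim.
apply: (@cvg_monotone_convergence _ _ _ P _ measurableT
  (fun n w => (nnsfun_approx measurableT mg n (f w) * Z w)%:E)).
- move=> n; apply/measurable_EFinP; apply: measurable_funM => //.
  exact: measurableT_comp.
- by move=> n w _; rewrite lee_fin mulr_ge0.
- move=> w _ m n mn; rewrite lee_fin ler_wpM2r//.
  exact/lefP/nd_nnsfun_approx.
Qed.

(** From indicators to nonnegative functions through simple functions and monotone convergence.
    Taking B = setT shows that c is the integral of Y; its finiteness lets multiplication by c pass
    to the limit. *)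
Lemma ge0_integral_comp_indep (f Y : T -> R) (g : R -> R) (c : \bar R) :
  measurable_fun setT f -> measurable_fun setT Y -> (forall w, 0 <= Y w)%R ->
  c \is a fin_num ->
  (forall B, measurable B ->
    \int[P]_w (\1_B (f w) * Y w)%:E = P (f @^-1` B) * c) ->
  measurable_fun setT g -> (forall x, 0 <= g x)%R ->
  \int[P]_w (g (f w) * Y w)%:E = \int[P]_w (g (f w))%:E * c.
Proof.
move=> mf mY Y0 cfin H mg g0.
have mg' : measurable_fun setT (EFin \o g) by exact/measurable_EFinP.
have L := cvg_integral_comp_approx mg' mf mY Y0 g0.
have m1 : measurable_fun setT (cst 1%R : T -> R) by exact: measurable_cst.
(* The same approximation with the constant weight 1 handles the right-hand side. *)
have /(cvgeZr cfin) := cvg_integral_comp_approx mg' mf m1 (fun=> ler01) g0.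
rewrite [X in _ --> X * _](_ : _ = \int[P]_w (g (f w))%:E); last first.
  by apply: eq_integral => w _; rewrite mulr1.
move=> L'.
rewrite -(cvg_lim _ L)// -(cvg_lim _ L')//; congr (limn _).
apply/funext => n; rewrite !integral_comp_nnsfun//.
rewrite ge0_sume_distrl; last first.
  by move=> y _; rewrite mule_ge0// integral_ge0// => w _; rewrite lee_fin mulr_ge0.
apply: eq_bigr => y _; rewrite -muleA; congr (_ * _); rewrite H//.
congr (_ * _); under eq_integral do rewrite mulr1.
pose B := f @^-1` (nnsfun_approx measurableT mg' n @^-1` [set y]).
transitivity (P (B `&` setT)); first by rewrite setIT.
have mB : measurable B by rewrite -[B]setTI; exact: mf.
by rewrite -(integral_indic P measurableT mB).
Qed.


Context {I : finType}.
Variables (D : {set I}) (X : I -> {RV P >-> R}).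
Hypothesis XI : independent_on D X.

Lemma indicator_prod (J : {set I}) (B : I -> set R) w :
  (\prod_(i in J) \1_(B i) (X i w) =
   \1_(\bigcap_(i in [set` J]) (X i @^-1` B i)) w :> R)%R.
Proof.
rewrite [RHS]indicE; have [XB|XB] := boolP (w \in _).
  rewrite big1// => i iJ; rewrite indicE mem_set//.
  by move: XB; rewrite inE => /(_ i iJ).
apply/eqP/prodf_eq0.
have : ~ (forall i, i \in J -> B i (X i w)).
  by move=> H; move/negP: XB; apply; rewrite inE => i /= iJ; exact: H.
move=> /existsNP[i /not_implyP[iJ Bi]]; exists i => //.
by rewrite indicE memNset.
Qed.

Lemma ge0_integral_prod_indep (J : {set I}) (g : I -> R -> R) :
  J \subset D -> (forall i, measurable_fun setT (g i)) ->
  (forall i x, i \in J -> 0 <= g i x)%R ->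
  (forall i, i \in J -> \int[P]_w (g i (X i w))%:E \is a fin_num) ->
  \int[P]_w (\prod_(i in J) g i (X i w))%:E =
  \prod_(i in J) \int[P]_w (g i (X i w))%:E.
Proof.
move=> JD.
suff H n (S : {set I}) (B : I -> set R) (f : I -> R -> R) : #|S| = n ->
    (forall i, measurable (B i)) -> (forall i, i \in J -> i \notin S -> f i = \1_(B i)) ->
    (forall i, measurable_fun setT (f i)) ->
    (forall i x, i \in J -> 0 <= f i x)%R ->
    (forall i, i \in J -> \int[P]_w (f i (X i w))%:E \is a fin_num) ->
    \int[P]_w (\prod_(i in J) f i (X i w))%:E =
    \prod_(i in J) \int[P]_w (f i (X i w))%:E.
  by apply: (H _ [set: I]%SET (fun=> setT)) => // i; rewrite finset.in_setT.
(* S is the set of factors not yet known to be indicators; one member of S is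
   replaced by an indicator at each step. *)
elim: n S B f => [|n IH] S B f.
  move=> /cards0_eq-> mB fB _ _ _.
  have {}fB i : i \in J -> f i = \1_(B i) by move=> /fB->//; rewrite finset.in_set0.
  have mXB i : measurable (X i @^-1` B i).
    by rewrite -[X in measurable X]setTI; exact: measurable_funP.
  have E1 i : i \in J -> \int[P]_w (f i (X i w))%:E = P (X i @^-1` B i).
    move=> iJ; rewrite -[in RHS](setIT (X i @^-1` B i)) -integral_indic//.
    by rewrite fB.
  under [RHS]eq_bigr => i iJ do rewrite E1//.
  rewrite -XI//.
  under eq_integral => w _.
    under eq_bigr => i iJ do rewrite fB//.
    rewrite indicator_prod; over.
  rewrite integral_indic ?setIT//.
  by apply: fin_bigcap_measurable => //; exact: finite_finset.
move=> Sn mB fB mf f0 ffin.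
have [e eS] : exists e, e \in S by apply/card_gt0P; rewrite Sn.
have SE : #|S :\ e| = n by move: Sn; rewrite (cardsD1 e) eS => -[].
have [eJ|eJ] := boolP (e \in J); last first.
  apply: (IH (S :\ e) B) => // i iJ; rewrite !inE negb_and negbK.
  by case/predU1P => [ie|/(fB i iJ)//]; move: eJ; rewrite -ie iJ.
rewrite (bigD1 e)//=.
pose Y w : R := (\prod_(i in J | i != e) f i (X i w))%R.
under eq_integral => w _ do rewrite (bigD1 e)//= -/(Y w).
have fe0 x : (0 <= f e x)%R by exact: f0.
apply: ge0_integral_comp_indep => //.
- rewrite /Y; under eq_fun do rewrite -big_filter.
  by apply: measurable_prod => i _; exact: measurableT_comp.
- by move=> w; apply: prodr_ge0 => i /andP[iJ _]; exact: f0.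
- by apply: prode_fin_num => i /andP[iJ _]; exact: ffin.
(* With factor e replaced by the indicator of an arbitrary [B0], the induction hypothesis applies to
   S without e. *)
move=> B0 mB0.
pose B' i := if i == e then B0 else B i.
pose f' i : R -> R := if i == e then \1_B0 else f i.
have f'e : f' e = \1_B0 by rewrite /f' eqxx.
have f'N i : i != e -> f' i = f i by rewrite /f' => /negPf->.
have mXB : measurable (X e @^-1` B0).
  by rewrite -[X in measurable X]setTI; exact: measurable_funP.
have Ee : \int[P]_w (f' e (X e w))%:E = P (X e @^-1` B0).
  by rewrite -[in RHS](setIT (X e @^-1` B0)) -integral_indic// f'e.
have -> : P (X e @^-1` B0) * \prod_(i in J | i != e) \int[P]_w (f i (X i w))%:E =
    \prod_(i in J) \int[P]_w (f' i (X i w))%:E.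
  rewrite [in RHS](bigD1 e)//= Ee; congr (_ * _).
  by apply: eq_bigr => i /andP[_ ie]; rewrite f'N.
rewrite -(IH (S :\ e) B' f' SE).
- apply: eq_integral => w _; rewrite [in RHS](bigD1 e)//= f'e; congr (_ * _)%:E.
  by apply: eq_bigr => i /andP[_ ie]; rewrite f'N.
- by move=> i; rewrite /B'; case: ifP.
- move=> i iJ; rewrite !inE negb_and negbK /f' /B'.
  by case: eqVneq => //= _; exact: fB.
- by move=> i; rewrite /f'; case: ifP => // _; exact: measurable_indic.
- by move=> i x iJ; rewrite /f'; case: ifP => _; rewrite ?indicE ?f0.
- move=> i iJ; have [->|ie] := eqVneq i e; first by rewrite Ee fin_num_measure.
  by rewrite f'N// ffin.
Qed.

(** The nonnegative case, applied to the absolute values, gives a finite product of finite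
    integrals. *)
Lemma integrable_prod_indep (J : {set I}) (g : I -> R -> R) :
  J \subset D -> (forall i, measurable_fun setT (g i)) ->
  (forall i, i \in J -> P.-integrable setT (fun w => (g i (X i w))%:E)) ->
  P.-integrable setT (fun w => (\prod_(i in J) g i (X i w))%:E).
Proof.
move=> JD mg gint; apply/integrableP; split.
  apply/measurable_EFinP; under eq_fun do rewrite -big_filter.
  by apply: measurable_prod => i _; exact: measurableT_comp.
have gfin i : i \in J -> \int[P]_w (`|g i (X i w)|)%:E \is a fin_num.
  move=> iJ; rewrite ge0_fin_numE ?integral_ge0//.
  by have /integrableP[_] := gint i iJ.
rewrite (_ : \int[P]_w _ = \int[P]_w (\prod_(i in J) `|g i (X i w)|)%:E).
  rewrite (@ge0_integral_prod_indep J (fun i x => `|g i x|%R))//.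
    rewrite -ge0_fin_numE; first exact: prode_fin_num.
    by apply: prode_ge0 => i _; exact: integral_ge0.
  by move=> i; exact: measurableT_comp.
by apply: eq_integral => w _; rewrite /= normr_prod.
Qed.

Lemma integral_prod_indep (J : {set I}) (g : I -> R -> R) :
  J \subset D -> (forall i, measurable_fun setT (g i)) ->
  (forall i, i \in J -> P.-integrable setT (fun w => (g i (X i w))%:E)) ->
  \int[P]_w (\prod_(i in J) g i (X i w))%:E =
  \prod_(i in J) \int[P]_w (g i (X i w))%:E.
Proof.
move=> JD.
suff H n (S : {set I}) (f : I -> R -> R) : #|S| = n ->
    (forall i x, i \in J -> i \notin S -> 0 <= f i x)%R ->
    (forall i, measurable_fun setT (f i)) ->
    (forall i, i \in J -> P.-integrable setT (fun w => (f i (X i w))%:E)) ->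
    \int[P]_w (\prod_(i in J) f i (X i w))%:E =
    \prod_(i in J) \int[P]_w (f i (X i w))%:E.
  by apply: (H _ [set: I]%SET) => // i x; rewrite finset.in_setT.
(* S is the set of factors not yet known to be nonnegative; one member of S is
   split into positive and negative part at each step. *)
elim: n S f => [|n IH] S f.
  move=> /cards0_eq-> f0 mf fint.
  apply: ge0_integral_prod_indep => // [i x iJ|i iJ].
    by rewrite f0// finset.in_set0.
  exact/integrable_fin_num/fint.
move=> Sn f0 mf fint.
have [e eS] : exists e, e \in S by apply/card_gt0P; rewrite Sn.
have SE : #|S :\ e| = n by move: Sn; rewrite (cardsD1 e) eS => -[].
have [eJ|eJ] := boolP (e \in J); last first.
  apply: (IH (S :\ e)) => // i x iJ; rewrite !inE negb_and negbK.
  by case/predU1P => [ie|/(f0 i x iJ)//]; move: eJ; rewrite -ie iJ.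
(* For s = 1 and s = -1 factor e becomes the positive and the negative part of [f e]. *)
pose part s i x : R := if i == e then Num.max (s * f e x)%R 0%R else f i x.
have partN s i x : i != e -> part s i x = f i x by rewrite /part => /negPf->.
have mpart s i : measurable_fun setT (part s i).
  rewrite /part; case: eqP => // _; apply: measurable_maxr => //.
  exact: measurable_funM.
have ipart s i : (s == 1 \/ s == -1)%R -> i \in J ->
    P.-integrable setT (fun w => (part s i (X i w))%:E).
  move=> s1 iJ; apply: le_integrable (fint i iJ) => //.
    by apply/measurable_EFinP; exact: measurableT_comp.
  move=> w _; rewrite /= lee_fin /part; case: eqP => [->|//].
  rewrite maxEle; case: ifP => _; first by rewrite normr0.
  by case: s1 => /eqP->; rewrite ?mul1r ?mulN1r ?normrN.
have partE w : (\prod_(i in J) f i (X i w) =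
    \prod_(i in J) part 1 i (X i w) - \prod_(i in J) part (-1) i (X i w))%R.
  have Ys s : (\prod_(i in J | i != e) part s i (X i w) =
      \prod_(i in J | i != e) f i (X i w))%R.
    by apply: eq_bigr => i /andP[_ ie]; rewrite partN.
  rewrite !(bigD1 e eJ)/= !Ys -mulrBl; congr (_ * _)%R.
  by rewrite /part eqxx mul1r mulN1r !maxEle; case: leP => h1; case: leP => h2; lra.
have IHs s : (s == 1 \/ s == -1)%R -> \int[P]_w (\prod_(i in J) part s i (X i w))%:E =
    \int[P]_w (part s e (X e w))%:E *
    \prod_(i in J | i != e) \int[P]_w (f i (X i w))%:E.
  move=> s1; rewrite (IH (S :\ e) (part s))//.
  - rewrite (bigD1 e)//=; congr (_ * _); apply: eq_bigr => i /andP[_ ie].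
    by apply: eq_integral => w _; rewrite partN.
  - move=> i x iJ; rewrite !inE negb_and negbK /part.
    by case: eqP => _ /= iS; [rewrite le_max lexx orbT|exact: f0].
  - by move=> i; exact: ipart.
under eq_integral => w _ do rewrite partE EFinB.
have s1 : ((1 : R) == 1 \/ (1 : R) == -1)%R by left.
have sN1 : ((-1 : R) == 1 \/ (-1 : R) == -1)%R by right.
rewrite integralB_EFin//; last 2 first.
- by apply: integrable_prod_indep => // i; exact: ipart.
- by apply: integrable_prod_indep => // i; exact: ipart.
rewrite !IHs// -muleBl; last 2 first.
- by apply: prode_fin_num => i /andP[iJ _]; exact/integrable_fin_num/fint.
- apply: fin_num_adde_defr; exact/integrable_fin_num/ipart.
rewrite [in RHS](bigD1 e)//=; congr (_ * _).
rewrite -integralB_EFin//; [|exact: ipart|exact: ipart].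
apply: eq_integral => w _; rewrite -EFinB; congr (_%:E).
by rewrite /part eqxx mul1r mulN1r !maxEle; case: leP => h1; case: leP => h2; lra.
Qed.

End Independence.

(** * Trace moments of the random matrix *)

Section TraceMoment.
Context {R : realType}.

(** Each factor is at most the largest one, whose power is one term of the sum. This reduces mixed
    moments to single ones without Hölder's inequality, at the price of a factor [size s] after
    integration. *)
Lemma norm_prod_le_sum (s : seq R) :
  s != [::] -> `|\prod_(x <- s) x| <= \sum_(x <- s) `|x| ^+ size s.
Proof.
move=> s0; have [m ms mP] : exists2 m, m \in s & forall x, x \in s -> `|x| <= `|m|.
  elim: s s0 => // a s IH _; have [->|/IH[m ms mP]] := eqVneq s [::].
    by exists a; rewrite ?mem_head// => x; rewrite inE => /eqP->.
  have [ma|am] := leP `|m| `|a|.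
    exists a; rewrite ?mem_head// => x; rewrite inE => /predU1P[->//|/mP xm].
    exact: le_trans ma.
  exists m; rewrite ?inE ?ms ?orbT// => x; rewrite inE => /predU1P[->|/mP//].
  exact: ltW.
apply: (@le_trans _ _ (`|m| ^+ size s)).
  rewrite normr_prod big_seq -[X in _ ^+ X]count_predT.
  apply: (@le_trans _ _ (\prod_(x <- s | x \in s) `|m|)).
    by apply: ler_prod => x xs; rewrite normr_ge0 mP.
  by rewrite -big_seq big_const_seq iter_mulr_1.
rewrite (big_rem m ms)/= lerDl sumr_ge0// => x _; exact: exprn_ge0.
Qed.

Context {d : measure_display} {T : measurableType d}.
Variable P : probability T R.
Context {I : finType}.
Variables (D : {set I}) (X : I -> {RV P >-> R}).
Hypothesis XI : independent_on D X.

Local Open Scope ereal_scope.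

Lemma prod_RV_bound (E : seq I) (K : R) : E != [::] ->
  (forall i, i \in E -> \int[P]_w (`|X i w| ^+ size E)%:E <= K%:E) ->
  \int[P]_w (`|\prod_(e <- E) X e w|)%:E <= (size E)%:R%:E * K%:E.
Proof.
move=> E0 EK.
have mX i : measurable_fun setT (fun w => (`|X i w| ^+ size E)%R).
  by apply: measurable_funX; exact: measurableT_comp.
apply: (@le_trans _ _ (\int[P]_w (\sum_(e <- E) (`|X e w| ^+ size E)%:E))).
  apply: ge0_le_integral => //.
  - apply/measurable_EFinP; apply: measurableT_comp => //.
    by apply: measurable_prod => i _.
  - by apply: emeasurable_sum => i; exact/measurable_EFinP.
  - move=> w _; rewrite sumEFin lee_fin.
    have := @norm_prod_le_sum [seq X e w | e <- E].
    by rewrite !big_map size_map; apply; case: (E) E0.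
rewrite ge0_integral_sum//; last by move=> i; exact/measurable_EFinP.
rewrite big_seq; apply: (@le_trans _ _ (\sum_(i <- E | i \in E) K%:E)).
  by apply: lee_sum => i /EK.
by rewrite -big_seq sumEFin big_const_seq count_predT iter_addr_0 -EFinM mulr_natl.
Qed.

Lemma integrable_prod_RV (E : seq I) (K : R) : E != [::] ->
  (forall i, i \in E -> \int[P]_w (`|X i w| ^+ size E)%:E <= K%:E) ->
  P.-integrable setT (fun w => (\prod_(e <- E) X e w)%:E).
Proof.
move=> E0 EK; apply/integrableP; split.
  by apply/measurable_EFinP; apply: measurable_prod => i _.
exact: le_lt_trans (prod_RV_bound E0 EK) (ltry _).
Qed.

(** Grouping equal indices gives a product of powers of independent variables, in which the centred
    variable [X e] occurs to the first power. *)
Lemma integral_prod_RV_eq0 (E : seq I) (e : I) :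
  {subset E <= D} -> e \in E -> count_mem e E = 1%N ->
  \int[P]_w (X e w)%:E = 0 ->
  (forall i m, i \in E -> (0 < m)%N -> \int[P]_w (`|X i w| ^+ m)%:E < +oo) ->
  \int[P]_w (\prod_(i <- E) X i w)%:E = 0.
Proof.
move=> ED eE e1 Xe0 Xfin.
pose g i (x : R) : R := (x ^+ count_mem i E)%R.
have mg i : measurable_fun setT (g i) by exact: measurable_funX.
pose J := [set i in E]%SET.
have -> : \int[P]_w (\prod_(i <- E) X i w)%:E =
    \int[P]_w (\prod_(i in J) g i (X i w))%:E.
  apply: eq_integral => w _; congr (_%:E); rewrite -prodr_undup_exp_count.
  rewrite big_uniq ?undup_uniq//; apply: eq_bigl => i.
  by rewrite finset.inE; exact: mem_undup.
rewrite (integral_prod_indep XI)//.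
- rewrite (bigD1 e)/=; last by rewrite finset.inE.
  under eq_integral do rewrite /g e1 expr1.
  by rewrite Xe0 mul0e.
- by apply/fintype.subsetP => i; rewrite finset.inE; exact: ED.
- move=> i; rewrite finset.inE => iE; apply/integrableP; split.
    by apply/measurable_EFinP; exact: measurableT_comp.
  under eq_integral do rewrite /= normrX.
  by apply: Xfin => //; rewrite -has_count has_pred1.
Qed.

End TraceMoment.

(** * Expected trace and its tail for the Wigner matrix *)

Section WignerTail.
Context {R : realType} {d : measure_display} {T : measurableType d}.
Variables (P : probability T R) (N : nat) (X : 'I_N -> 'I_N -> {RV P >-> R}).
Variable B : R.
Hypothesis X_indep : independent_on
  [set p : 'I_N * 'I_N | (p.1 <= p.2)%N]%SET (fun p => X p.1 p.2).
Hypothesis X_mean : forall j l : 'I_N, (j <= l)%N -> ('E_P[X j l] = 0)%E.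
Hypothesis X_moments : forall (j l : 'I_N) (m : nat), (j <= l)%N -> (1 <= m)%N ->
  ('E_P[(fun w => `|X j l w| ^+ m)%R] <= (m%:R `^ (B * m%:R))%:E)%E.

Lemma wigner_sym w : (wigner X w)^T = wigner X w.
Proof. by apply/matrixP => a b; rewrite !mxE minC maxC. Qed.

Definition wigner_trace (p : nat) (w : T) : R :=
  \tr (iter p.*2 (mulmx (wigner X w)) 1%:M).

Lemma wigner_traceE p w : wigner_trace p w =
  \sum_(t : p.*2.+1.-tuple 'I_N) (last (thead t) t == thead t)%:R *
     \prod_(e <- walk_edges t) X e.1 e.2 w.
Proof.
rewrite /wigner_trace (trace_power (X := fun a b => X a b w))// => a b.
by rewrite mxE.
Qed.

Lemma wigner_trace_ge0 p w : 0 <= wigner_trace p w.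
Proof.
have [Q [q [QQ WE]]] := spectral_decomposition (wigner_sym w).
rewrite /wigner_trace (symmetric_powE _ QQ WE) -mulmxA mxtrace_mulC -mulmxA QQ mulmx1.
rewrite mxtrace_diag sumr_ge0// => j _; rewrite mxE -muln2 exprM; exact: sqr_ge0.
Qed.

Lemma measurable_wigner_trace p : measurable_fun setT (wigner_trace p).
Proof.
rewrite (funext (wigner_traceE p)); apply: measurable_sum => t.
by apply: measurable_funM => //; apply: measurable_prod => e _.
Qed.

(** Walk edges lie in the index set on which independence, means and moments are assumed. *)
Lemma walk_edges_le (t : seq 'I_N) e : e \in walk_edges t -> (e.1 <= e.2)%N.
Proof.
case/mapP => -[a b] _ ->; rewrite /sym_edge/=.
by case: (leP a b) => [ab|/ltW ab]; exact: ab.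
Qed.

Local Open Scope ereal_scope.

Lemma integral_wigner_trace (p : nat) : (0 < p)%N ->
  \int[P]_w (wigner_trace p w)%:E <=
  ((N ^ p.+1 * p.+1 ^ p.*2.+1)%:R *
   (p.*2%:R * (p.*2%:R `^ (B * p.*2%:R))))%:E.
Proof.
move=> p0; pose K : R := (p.*2%:R `^ (B * p.*2%:R))%R.
have szE (t : p.*2.+1.-tuple 'I_N) : size (walk_edges t) = p.*2.
  by rewrite size_map size_zip size_behead size_tuple/= (minn_idPr (leqnSn _)).
have E0 (t : p.*2.+1.-tuple 'I_N) : walk_edges t != [::].
  by rewrite -size_eq0 szE double_eq0 -lt0n.
have EK (t : p.*2.+1.-tuple 'I_N) e : e \in walk_edges t ->
    \int[P]_w (`|X e.1 e.2 w| ^+ size (walk_edges t))%:E <= K%:E.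
  move=> /walk_edges_le e12; have := X_moments e12 (m := p.*2).
  by rewrite unlock szE; apply; rewrite double_gt0.
have Xfin (e : 'I_N * 'I_N) m : (e.1 <= e.2)%N -> (0 < m)%N ->
    \int[P]_w (`|X e.1 e.2 w| ^+ m)%:E < +oo.
  move=> e12 m0; have := X_moments e12 m0; rewrite unlock => /le_lt_trans; apply.
  exact: ltry.
pose Z (t : p.*2.+1.-tuple 'I_N) w : \bar R := ((last (thead t) t == thead t)%:R *
  \prod_(e <- walk_edges t) X e.1 e.2 w)%:E.
have iZ t : P.-integrable setT (Z t).
  rewrite /Z; under eq_fun do rewrite EFinM; apply: integrableZl => //.
  exact: (integrable_prod_RV (X := fun e => X e.1 e.2) (E0 t) (EK t)).
under eq_integral => w _ do rewrite wigner_traceE -sumEFin.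
rewrite integral_sum//.
rewrite (bigID (fun t : p.*2.+1.-tuple 'I_N => size (undup t) <= p.+1)%N)/=.
rewrite [X in _ + X]big1 ?adde0; last first.
  (* By contraposition of [walk_few_vertices], more than p + 1 vertices force an edge used once, and
     the expectation vanishes. *)
  move=> t tp; have /hasP[e et /eqP e1] :
      has (fun e => count_mem e (walk_edges t) == 1%N) (walk_edges t).
    apply: contraR tp => /hasPn tc.
    by apply: walk_few_vertices => //; rewrite size_tuple.
  under eq_integral do rewrite EFinM.
  rewrite integralZl//; last first.
    exact: (integrable_prod_RV (X := fun e => X e.1 e.2) (E0 t) (EK t)).
  rewrite (integral_prod_RV_eq0 X_indep (e := e))//.
  - by rewrite mule0.
  - by move=> a /walk_edges_le; rewrite finset.inE.
  - by have := X_mean (walk_edges_le et); rewrite unlock.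
  - by move=> a m /walk_edges_le; exact: Xfin.
(* The closing indicator is bounded by 1, so the count below runs over all tuples with at most p + 1
   values. *)
have tK t : \int[P]_w Z t w <= (p.*2%:R * K)%:E.
  apply: le_trans (lee_abs _) _; apply: le_trans (le_abse_integral _ _ _) _ => //.
    by have /integrableP[] := iZ t.
  rewrite EFinM -(szE t).
  apply: le_trans _ (prod_RV_bound (X := fun e => X e.1 e.2) (E0 t) (EK t)).
  apply: ge0_le_integral => //.
  - by apply: measurableT_comp => //; have /integrableP[] := iZ t.
  - apply/measurable_EFinP; apply: measurableT_comp => //.
    by apply: measurable_prod => e _.
  - move=> w _; rewrite lee_fin normrM ler_piMl//.
    by case: (_ == _); rewrite ?normr1 ?normr0.
apply: le_trans (lee_sum _ (fun t _ => tK t)) _.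
rewrite sumEFin lee_fin sumr_const -[leLHS]mulr_natl ler_wpM2r//.
  by rewrite mulr_ge0// powR_ge0.
rewrite ler_nat; have := card_few_values 'I_N p.*2 p.+1; rewrite card_ord.
by rewrite cardsE.
Qed.

(** Markov's inequality, the trace of an even power being nonnegative. *)
Lemma wigner_trace_tail (p : nat) (t : R) : (0 < p)%N -> (0 < t)%R ->
  (fine (P [set w | t < wigner_trace p w]) <=
  (N ^ p.+1 * p.+1 ^ p.*2.+1)%:R *
   (p.*2%:R * (p.*2%:R `^ (B * p.*2%:R))) / t)%R.
Proof.
move=> p0 t0; set A := [set w | _].
have mA : measurable A.
  rewrite (_ : A = wigner_trace p @^-1` `]t, +oo[%classic).
    by rewrite -[X in measurable X]setTI; exact: measurable_wigner_trace.
  by apply/seteqP; split => w /=; rewrite in_itv/= andbT.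
rewrite ler_pdivlMr// -lee_fin EFinM fineK ?fin_num_measure// muleC.
apply: le_trans _ (integral_wigner_trace p0).
rewrite -[A in leLHS]setIT -integral_indic// -ge0_integralZl_EFin ?(ltW t0)//.
- apply: ge0_le_integral => //.
  + by move=> w _; rewrite -EFinM lee_fin mulr_ge0// ltW.
  + by apply/measurable_funeM/measurable_EFinP/measurable_indic.
  + exact/measurable_EFinP/measurable_wigner_trace.
  + move=> w _; rewrite -EFinM lee_fin indicE; case: (boolP (w \in A)).
      by rewrite inE /= mulr1 => /ltW.
    by rewrite mulr0 wigner_trace_ge0.
- by apply/measurable_EFinP/measurable_indic.
Qed.

End WignerTail.

(** * Measurability of the eigenvalues *)

Section EigvalMeasurable.
Context {R : realType}.

Lemma eigval_lipschitz n (A C : 'M[R]_n) (i : 'I_n) (r : R) :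
  A^T = A -> C^T = C -> (forall a b, `|A a b - C a b| <= r) ->
  eigval A i <= eigval C i + n%:R * r.
Proof.
move=> AT CT ACr; apply: eigval_perturb => // x.
have -> : qform A x = qform C x + qform (A - C) x.
  rewrite /qform mulmxBr mulmxBl.
  by rewrite [X in _ = _ + X]mxE [X in _ + (_ + X)]mxE; ring.
rewrite lerD2l (le_trans (ler_norm _))//; apply: bilinear_bound => a b.
by have := ACr a b; rewrite !mxE.
Qed.

(** [whp] asks for measurable events, while [eigval] is defined by choice; measurability is drawn
    from continuity on symmetric matrices. *)
Lemma measurable_eigval d (T : measurableType d) n (M : T -> 'M[R]_n) (i : 'I_n) :
  (forall w, (M w)^T = M w) ->
  (forall a b, measurable_fun setT (fun w => M w a b)) ->
  measurable_fun setT (fun w => eigval (M w) i).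
Proof.
move=> MT mM mT; apply: (measurability _ (RGenOInfty.measurableE R)) => //.
move=> /= _ [_ [c ->] <-]; rewrite preimage_itvoy setTI.
(* By the Lipschitz bound the superlevel set is, among symmetric matrices, a
   union of balls with rational centre and radius. *)
pose near (q : 'M[rat]_n * rat) (A : 'M[R]_n) :=
  forall a b, `|A a b - ratr (q.1 a b)| < ratr q.2.
pose good q := forall A : 'M[R]_n, A^T = A -> near q A -> c < eigval A i.
pose F q : set T := [set w | good q /\ near q (M w)].
rewrite [X in measurable X](_ : _ = \bigcup_q F q).
  apply: countable_bigcupT_measurable => [|q]; first exact: countableP.
  have [gq|ngq] := pselect (good q); last first.
    by rewrite [F q](_ : _ = set0)//; apply/seteqP; split => // w [].
  rewrite [F q](_ : _ = \bigcap_(ab in [set: 'I_n * 'I_n])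
      [set w | `|M w ab.1 ab.2 - ratr (q.1 ab.1 ab.2)| < ratr q.2]).
    apply: fin_bigcap_measurable; first exact: finite_finset.
    move=> [a b] _ /=.
    rewrite [X in measurable X](_ : _ = (fun w => M w a b) @^-1`
      `](ratr (q.1 a b) - ratr q.2), (ratr (q.1 a b) + ratr q.2)[%classic).
      by rewrite -[X in measurable X]setTI; exact: mM.
    by apply/seteqP; split => w /=; rewrite in_itv/= ltr_distl.
  apply/seteqP; split => w /=; first by move=> [_ qM] [a b] _; exact: qM.
  by move=> qM; split => // a b; exact: (qM (a, b)).
apply/seteqP; split => w /=; last by move=> [q _ [gq qM]]; exact: gq.
move=> cM; set gap := eigval (M w) i - c.
have gap0 : 0 < gap by rewrite subr_gt0.
(* Entries of two matrices in a ball of radius r differ by at most 2 r, moving the eigenvalue by at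
   most 2 n r, which is below [gap] for this choice. *)
have : 0 < gap / (n%:R * 2 + 1) by rewrite divr_gt0// ltr_wpDl// mulr_ge0.
move=> /rat_in_itvoo[r]; rewrite in_itv/= => /andP[r0 rgap].
have Qex a b : exists q : rat, `|M w a b - ratr q| < ratr r.
  have : M w a b - ratr r < M w a b + ratr r by rewrite ltrBlDr -addrA ltrDl addr_gt0.
  move=> /rat_in_itvoo[q]; rewrite in_itv/= -ltr_distl => qM.
  by exists q; rewrite distrC.
pose Q : 'M[rat]_n := \matrix_(a, b) projT1 (cid (Qex a b)).
have QM : near (Q, r) (M w).
  by move=> a b; rewrite /Q mxE; exact: projT2 (cid (Qex a b)).
exists (Q, r) => //; split => // A AT QA.
have : eigval (M w) i <= eigval A i + n%:R * (2 * ratr r).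
  apply: eigval_lipschitz => // a b.
  rewrite -(subrKA (ratr (Q a b))) (le_trans (ler_normD _ _))//.
  have := QM a b; have := QA a b; rewrite /= distrC.
  by move: `|_| `|_| => u v; lra.
have : ratr r * (n%:R * 2 + 1) < gap by rewrite -ltr_pdivlMr// ltr_wpDl// mulr_ge0.
by rewrite /gap; lra.
Qed.

End EigvalMeasurable.

(** * Asymptotics *)

Section TailAsymptotics.
Context {R : realType}.

(** The quotient is at most N (a s) x^(2p) with a = p + 1 and s = 2p; [big] makes 4 x at most 1/e,
    leaving N exp(-2p). *)
Lemma moment_bound_tail (N p : nat) (B xi C dl th : R) (L := ln N%:R : R) :
  0 <= B -> 0 < C -> 0 < dl -> 0 < th -> 1 <= L ->
  L ^+ 2 <= p%:R <= 2 * L ^+ 2 ->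
  Num.sqrt N%:R * L `^ xi <= C * th ->
  4 * 4 `^ (B + 1) * (C / dl) * expR 1 <= L `^ (xi - 2 * (B + 1)) ->
  (N ^ p.+1 * p.+1 ^ p.*2.+1)%:R * (p.*2%:R * (p.*2%:R `^ (B * p.*2%:R)))
    / (dl * th) ^+ p.*2 <= expR (- (L `^ 2)).
Proof.
move=> B0 C0 dl0 th0 L1 /andP[Lp pL] Nth big.
have L0 : 0 < L by lra.
have LL : L <= L ^+ 2 by rewrite expr2 ler_peMr// ltW.
have N0 : 0 < N%:R :> R.
  by rewrite ltr0n lt0n; apply: contraTneq L0 => N0; rewrite /L N0 ln0 ?ltxx.
have p1 : (0 < p)%N by rewrite -(@ltr_nat R) (lt_le_trans _ Lp)// exprn_gt0.
set q := p.*2; set s : R := q%:R; set a : R := p.+1%:R; set b := s `^ B.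
have sE : s = 2 * p%:R by rewrite /s /q -muln2 natrM mulrC.
have s0 : 0 < s by rewrite sE mulr_gt0// ltr0n.
have as_ : a <= s by rewrite /a /s ler_nat /q -addnn -addn1 leq_add2l.
have a0 : 0 < a by rewrite ltr0n.
have b0 : 0 < b by rewrite powR_gt0.
have bE : s `^ (B * s) = b ^+ q by rewrite powRrM -powR_mulrn// ltW.
have Lxi0 : 0 < L `^ xi by rewrite powR_gt0.
(* [x] collects everything raised to the power 2p once N^p is bounded by (C th / L^xi)^(2p). *)
pose x := a * b * (C / (dl * L `^ xi)).
have x0 : 0 <= x by rewrite /x ltW// !(mulr_gt0, invr_gt0).
have x4 : 4 * x <= expR (-1).
  have ab : a * b <= 4 `^ (B + 1) * L `^ (2 * (B + 1)).
    apply: (@le_trans _ _ (s * s `^ B)); first by rewrite ler_pM2r.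
    have -> : s * s `^ B = s `^ (B + 1).
      rewrite powRD; first by rewrite powRr1 ?(ltW s0)// mulrC.
      by rewrite (gt_eqF s0) implybT.
    rewrite powRrM powR_mulrn ?(ltW L0)// -powRM ?sqr_ge0//.
    apply: ge0_ler_powR; rewrite ?nnegrE ?addr_ge0 ?mulr_ge0 ?sqr_ge0 ?(ltW s0) ?(ltW L0)//.
    by rewrite sE; lra.
  rewrite expRN -(ler_pM2r (expR_gt0 1)) mulVf ?(gt_eqF (expR_gt0 1))//.
  apply: (@le_trans _ _ (4 * (4 `^ (B + 1) * L `^ (2 * (B + 1)) *
     (C / (dl * L `^ xi))) * expR 1)).
    rewrite ler_pM2r ?expR_gt0// ler_pM2l// /x ler_wpM2r//.
    by rewrite ltW// !(mulr_gt0, invr_gt0).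
  have -> : 4 * (4 `^ (B + 1) * L `^ (2 * (B + 1)) * (C / (dl * L `^ xi))) * expR 1 =
     (4 * 4 `^ (B + 1) * (C / dl) * expR 1) * (L `^ (2 * (B + 1)) / L `^ xi).
    by field; rewrite !gt_eqF.
  have -> : L `^ (2 * (B + 1)) / L `^ xi = (L `^ (xi - 2 * (B + 1)))^-1.
    rewrite powRB; last by rewrite (gt_eqF L0) implybT.
    by rewrite invf_div.
  by rewrite ler_pdivrMr ?powR_gt0// mul1r.
(* The polynomial prefactor is absorbed into (4 x)^(2p). *)
have asq : a * s <= 4 ^+ q.
  have sq : s <= 2 ^+ q by rewrite /s -natrX ler_nat ltnW// ltn_expl.
  have -> : 4 ^+ q = 2 ^+ q * 2 ^+ q :> R by rewrite -exprMn; congr (_ ^+ _); ring.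
  by rewrite ler_pM ?(ltW a0) ?(ltW s0)// (le_trans as_).
have y0 : 0 < C * th / L `^ xi by rewrite !(mulr_gt0, invr_gt0).
have yN : Num.sqrt N%:R <= C * th / L `^ xi by rewrite ler_pdivlMr.
have yq : N%:R ^+ p <= (C * th / L `^ xi) ^+ q.
  rewrite /q -muln2 mulnC exprM -[N%:R in leLHS]sqr_sqrtr ?ler0n//.
  by rewrite lerXn2r ?nnegrE ?exprn_ge0 ?sqrtr_ge0 ?(ltW y0)// lerXn2r
    ?nnegrE ?sqrtr_ge0 ?(ltW y0).
apply: (@le_trans _ _ (N%:R * (a * s * x ^+ q))).
  rewrite ler_pdivrMr ?exprn_gt0 ?mulr_gt0// bE.
  have -> : N%:R * (a * s * x ^+ q) * (dl * th) ^+ q =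
     N%:R * (a * s) * (a * b) ^+ q * (C * th / L `^ xi) ^+ q.
    rewrite -!mulrA; congr (_ * (_ * (_ * _))); rewrite -!exprMn; congr (_ ^+ _).
    by rewrite /x; field; rewrite !gt_eqF.
  have -> : (N ^ p.+1 * p.+1 ^ q.+1)%:R * (s * b ^+ q) =
     N%:R * (a * s) * (a * b) ^+ q * N%:R ^+ p.
    by rewrite natrM !natrX !exprS exprMn -/a; ring.
  by rewrite ler_wpM2l// !mulr_ge0 ?exprn_ge0 ?mulr_ge0 ?ltW.
apply: (@le_trans _ _ (N%:R * expR (-1) ^+ q)).
  rewrite ler_pM2l//; apply: (@le_trans _ _ ((4 * x) ^+ q)).
    by rewrite [leRHS]exprMn ler_wpM2r ?exprn_ge0.
  by rewrite lerXn2r ?nnegrE ?expR_ge0 ?(mulr_ge0 _ x0)//.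
(* The exponent is L - 2p <= L - 2 L^2 <= -L^2. *)
rewrite -[N%:R]lnK ?posrE// -/L -expRM_natl -expRD ler_expR -/s powR_mulrn ?(ltW L0)// sE.
lra.
Qed.

End TailAsymptotics.

(** * Relative error of the spiked eigenvalues *)

Lemma near_ln_ge (R : realType) (M : R) : \forall N \near \oo, M <= ln N%:R.
Proof.
near=> N; have MN : expR M <= N%:R.
  rewrite (le_trans (ltW (truncnS_gt _)))// ler_nat.
  by near: N; exact: nbhs_infty_ge.
by rewrite -[M]expRK ler_ln ?posrE ?expR_gt0// (lt_le_trans (expR_gt0 M)).
Unshelve. all: by end_near. Qed.

(** The error term is an explicit family [Y]. Indices start at 0, and the identity is stated for i <
    N, since beyond that [eigval] returns the default 0. *)
Theorem theorem3p1
  (R : realType) (k : nat) (hk : (1 <= k)%N)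
  (alpha : 'I_k -> R)
  (alpha_gt0 : forall i, 0 < alpha i)
  (alpha_decr : forall i j : 'I_k, (i < j)%N -> alpha j < alpha i)
  (B : R) (B_gt0 : 0 < B)
  (f : R -> R -> R)
  (f_ge0 : forall x y : R, x \in `[0, 1] -> y \in `[0, 1] -> 0 <= f x y)
  (f_bounded : bounded_on_square f)
  (f_integrable : riemann_integrable_square f)
  (d : nat -> measure_display) (T : forall N, measurableType (d N))
  (P : forall N, probability (T N) R)
  (X : forall N, 'I_N -> 'I_N -> {RV (P N) >-> R})
  (X_indep : forall N, independent_on
     [set p : 'I_N * 'I_N | (p.1 <= p.2)%N]%SET (fun p => X N p.1 p.2))
  (X_mean : forall N (j l : 'I_N), (j <= l)%N -> ('E_(P N)[X N j l] = 0)%E)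
  (X_var : forall N (j l : 'I_N), (j <= l)%N ->
     ('V_(P N)[X N j l] = (f (gridpt j) (gridpt l))%:E)%E)
  (X_moments : forall N (j l : 'I_N) (m : nat), (j <= l)%N -> (1 <= m)%N ->
     ('E_(P N)[(fun w => `|X N j l w| ^+ m)%R] <= (m%:R `^ (B * m%:R))%:E)%E)
  (theta : nat -> R) (theta_gt0 : forall N, 0 < theta N)
  (xi : R) (hxi : Num.max (4 * (B + 1)) 8 < xi)
  (theta_lower : (fun N => Num.sqrt N%:R * (ln N%:R `^ xi) : R^o)
                 =O_\oo (theta : nat -> R^o))
  (theta_upper : (theta : nat -> R^o) =O_\oo (fun N => N%:R : R^o))
  (h : 'I_k -> R -> R)
  (h_bounded : forall i, bounded_on01 (h i))
  (h_orthonormal : orthonormal01 h)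
  (e_asymptotic : forall i j : 'I_k,
     (fun N => ((discretize N (h i))^T *m discretize N (h j)) 0 0) @ \oo
       --> inner01 (h i) (h j)) :
  forall i : 'I_k,
    exists2 Y : forall N, T N -> R,
      o_hp P Y (fun N _ => 1) &
      forall N (w : T N), (i < N)%N ->
        eigval (perturbed alpha h (theta N) (X N) w) i
        = theta N * alpha i * (1 + Y N w).
Proof.
move=> i.
have tha0 N : 0 < theta N * alpha i by rewrite mulr_gt0.
pose M N w := perturbed alpha h (theta N) (X N) w.
pose Y N w : R :=
  if (i < N)%N then eigval (M N w) i / (theta N * alpha i) - 1 else 0.
exists Y; last first.
  move=> N w iN; rewrite /Y iN addrC subrK mulrC divfK//.
  by rewrite gt_eqF.
have MT N w : (M N w)^T = M N w.
  rewrite /M /perturbed linearD/= wigner_sym linearZ/= linear_sum/=.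
  congr (_ + _ *: _); apply: eq_bigr => a _.
  by rewrite linearZ/= trmx_mul trmxK.
have mY N : measurable_fun setT (Y N).
  rewrite /Y; case: (boolP (i < N)%N) => [iN|_]; last exact: measurable_cst.
  apply: measurable_funB => //; apply: measurable_funM => //.
  apply: (measurable_eigval (Ordinal iN) (MT N)) => a b.
  rewrite (_ : (fun w => _) = (fun w => X N (Order.min a b) (Order.max a b) w +
     (theta N *: \sum_(c < k) alpha c *: (discretize N (h c) *m (discretize N (h c))^T)) a b)).
    exact: measurable_funD.
  by apply/funext => w; rewrite /M /perturbed mxE; congr (_ + _); rewrite mxE.
move=> delta delta0; split.
  move=> N; rewrite [X in measurable X](_ : _ = Y N @^-1` `[- delta, delta]%classic).
    by rewrite -[X in measurable X]setTI; exact: mY.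
  by apply/seteqP; split => w /=; rewrite in_itv/= normr1 mulr1 ler_norml.
exists 2; first by rewrite ltr1n.
(* The entry 1/2 meets the requirement of [spiked_eigval]; delta / 4 makes its Gram error 2 k eps at
   most delta / 2. The other half of delta goes to the norm of W through [dl]. *)
pose eps : R := Num.min (1 / 2) (delta / 4) / k%:R.
have k0 : 0 < k%:R :> R by rewrite ltr0n.
have keps : k%:R * eps = Num.min (1 / 2) (delta / 4) by rewrite /eps mulrC divfK// gt_eqF.
have eps0 : 0 < eps by rewrite divr_gt0// lt_min !divr_gt0.
pose dl : R := delta * alpha i / 2.
have dl0 : 0 < dl by rewrite /dl divr_gt0// mulr_gt0.
move/eqO_exP : theta_lower => [C C0 thC].
have xiB : 0 < xi - 2 * (B + 1).
  by move: hxi; rewrite gt_max => /andP[hxi _]; lra.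
pose K : R := 4 * 4 `^ (B + 1) * (C / dl) * expR 1.
have K0 : 0 < K by rewrite /K !(mulr_gt0, invr_gt0) ?powR_gt0 ?expR_gt0.
apply/eqO_exP; exists 1 => //.
(* Finitely many pairs, so one threshold on N serves them all. *)
have gram : \forall N \near \oo, forall ab : 'I_k * 'I_k,
    `|((discretize N (h ab.1))^T *m discretize N (h ab.2)) 0 0 - (ab.1 == ab.2)%:R| <= eps.
  apply: filter_forall => -[a b] /=.
  have := e_asymptotic a b; rewrite h_orthonormal.2 => /cvgrPdist_le/(_ _ eps0).
  by apply: filterS => N; rewrite distrC.
near=> N.
have iN : (i < N)%N by rewrite (leq_trans (ltn_ord i))//; near: N; exact: nbhs_infty_ge.
pose L : R := ln N%:R.
have L1 : 1 <= L by rewrite /L; near: N; exact: near_ln_ge.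
(* As xi > 2 (B + 1), a large log N gives K <= L^(xi - 2 (B + 1)). *)
have LK : K `^ (xi - 2 * (B + 1))^-1 <= L by rewrite /L; near: N; exact: near_ln_ge.
have L0 : 0 < L by lra.
have LKx : K <= L `^ (xi - 2 * (B + 1)).
  have -> : K = (K `^ (xi - 2 * (B + 1))^-1) `^ (xi - 2 * (B + 1)).
    by rewrite -powRrM mulVf ?lt0r_neq0// powRr1// ltW.
  by apply: ge0_ler_powR; rewrite ?nnegrE ?powR_ge0 ?(ltW xiB) ?(ltW L0).
have thN : Num.sqrt N%:R * L `^ xi <= C * theta N.
  have : `|Num.sqrt N%:R * ln N%:R `^ xi| <= C * `|theta N| by near: N.
  by rewrite (ger0_norm (ltW (theta_gt0 N))); apply: le_trans; exact: ler_norm.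
have GN : forall ab : 'I_k * 'I_k,
    `|((discretize N (h ab.1))^T *m discretize N (h ab.2)) 0 0 - (ab.1 == ab.2)%:R| <= eps.
  by near: N.
have Gab a b : `|((discretize N (h a))^T *m discretize N (h b)) 0 0 - (a == b)%:R| <= eps.
  exact: (GN (a, b)).
have keps2 : k%:R * eps <= 1 / 2 by rewrite keps ge_min lexx.
(* The successor makes p positive and at least L^2; since L >= 1, also p <= L^2 + 1 <= 2 L^2. *)
pose p := (Num.truncn (L ^+ 2)).+1.
have LL : 1 <= L ^+ 2 by rewrite exprn_ege1.
have Lp : L ^+ 2 <= p%:R <= 2 * L ^+ 2.
  have /andP[tL Lt] := truncn_itv (ltW (lt_le_trans ltr01 LL)).
  by rewrite (ltW Lt)/= /p -natr1; lra.
have dth0 : 0 < dl * theta N by rewrite mulr_gt0.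
set E := ~` _.
have mE : measurable E.
  apply: measurableC; rewrite [X in measurable X](_ : _ = Y N @^-1` `[- delta, delta]%classic).
    by rewrite -[X in measurable X]setTI; exact: mY.
  by apply/seteqP; split => w /=; rewrite in_itv/= normr1 mulr1 ler_norml.
pose A := [set w | (dl * theta N) ^+ p.*2 < wigner_trace (X N) p w].
have mA : measurable A.
  rewrite (_ : A = wigner_trace (X N) p @^-1` `](dl * theta N) ^+ p.*2, +oo[%classic).
    by rewrite -[X in measurable X]setTI; exact: measurable_wigner_trace.
  by apply/seteqP; split => w /=; rewrite in_itv/= andbT.
(* Off [A] the trace bounds the form of W by dl theta, and [spiked_eigval] keeps the relative error
   within delta. *)
have EA : E `<=` A.
  move=> w /= Ew; rewrite /A /= ltNge; apply/negP => tr; apply: Ew => /=.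
  have Wt := qform_le_trace (wigner_sym (X N) w) (ltW dth0) (ltn0Sn _) tr.
  have eE := spiked_eigval (wigner_sym (X N) w) (theta_gt0 N) iN alpha_gt0
    alpha_decr Wt Gab keps2.
  rewrite keps in eE.
  rewrite /Y iN normr1 mulr1.
  have -> : eigval (M N w) i / (theta N * alpha i) - 1 =
      (eigval (M N w) i - theta N * alpha i) / (theta N * alpha i).
    by rewrite mulrBl divff// gt_eqF.
  rewrite normrM normfV (gtr0_norm (tha0 N)) ler_pdivrMr//.
  apply: le_trans eE _.
  have : Num.min (1 / 2) (delta / 4) * (theta N * alpha i) <=
      delta / 4 * (theta N * alpha i).
    by rewrite ler_pM2r// ge_min lexx orbT.
  by rewrite /dl; lra.
rewrite mul1r !ger0_norm ?expR_ge0 ?fine_ge0//.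
apply: (@le_trans _ _ (fine (P N A))).
  by rewrite fine_le ?fin_num_measure// le_measure// inE.
apply: le_trans (moment_bound_tail (ltW B_gt0) C0 dl0 (theta_gt0 N) L1 Lp thN LKx).
by apply: (wigner_trace_tail (X_indep N) (X_mean N) (X_moments N)); rewrite ?exprn_gt0.
Unshelve. all: by end_near. Qed.
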